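(* Let $\lambda$, $\mu$, $\nu$ be partitions of $m$ of length $4$, $2$, $2$, respectively. Suppose that $\lambda_3=\lambda_4$ and that $2\lambda_3\le\nu_2\le\mu_2$. Let \[ x=\max\left(0,\left\lceil \tfrac{\nu_2+\mu_2+\lambda_2-\lambda_3-m}{2}\right\rceil\right),\qquad y=\left\lceil\tfrac{\nu_2+\lambda_2-\mu_2-\lambda_3+1}{2}\right\rceil,\qquad z=\left\lceil\tfrac{\nu_2+\mu_2-\lambda_2-3\lambda_3+1}{2}\right\rceil . \] We have: (1) If $\lambda_2+\lambda_3\le\mu_2$, then $\mathsf{k}(\lambda,\mu,\nu)=(y-x)(y\ge x)$. (2) If $\lambda_2+\lambda_3>\mu_2$, then $\mathsf{k}(\lambda,\mu,\nu)=(z-x)(z\ge x)$.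
   Context: A partition is a vector $\lambda=(\lambda_1,\dots,\lambda_p)$ of nonnegative integers with $\lambda_1\ge\cdots\ge\lambda_p$; two partitions differing only by a string of zeros at the end are considered equal. The length of a partition is the number of its positive parts; $\lambda$ is a partition of $m$ if its parts sum to $m$. For partitions $\lambda,\mu,\nu$ of a positive integer $m$, let $\chi^\lambda,\chi^\mu,\chi^\nu$ be the corresponding complex irreducible characters of the symmetric group $\mathsf{S}_m$. The Kronecker coefficient is $\mathsf{k}(\lambda,\mu,\nu):=\langle \chi^\lambda\otimes\chi^\mu,\chi^\nu\rangle$, the multiplicity of $\chi^\nu$ in the Kronecker product $\chi^\lambda\otimes\chi^\mu$ (the pointwise product of characters), where $\langle\cdot,\cdot\rangle$ is the inner product of complex characters of $\mathsf{S}_m$. The notation $(b\ge a)$, used as a factor, means $1$ if $b\ge a$ and $0$ otherwise. *)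

(* Defs.v *)
From mathcomp Require Import all_boot all_order all_fingroup all_algebra.
From mathcomp Require Import all_field all_character.

Set Implicit Arguments.
Unset Strict Implicit.
Unset Printing Implicit Defensive.

Import GRing.Theory Num.Theory.
Local Open Scope ring_scope.

(* Trailing zeros are allowed; they affect none of the notions below. *)
Definition partition_of (m : nat) (lam : seq nat) : bool :=
  sorted geq lam && (sumn lam == m).

Definition plength (lam : seq nat) : nat := count (fun a => 0 < a)%N lam.

(* 1-based: part lam i is $\lambda_i$, and 0 beyond the end of lam. *)
Definition part (lam : seq nat) (i : nat) : nat := nth 0%N lam i.-1.

Section Specht.

Variables (m : nat) (lam : seq nat).

(* The tableau used is the one of shape lam filled with 0, ..., m.-1 row by
   row, in which k lies in row [reshape_index lam k] and in column
   [reshape_offset lam k]. *)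
Definition row_stab : {set 'S_m} :=
  [set s : 'S_m |
    [forall k : 'I_m, reshape_index lam (s k) == reshape_index lam k]].

Definition col_stab : {set 'S_m} :=
  [set s : 'S_m |
    [forall k : 'I_m, reshape_offset lam (s k) == reshape_offset lam k]].

Local Notation regS := (regular_repr algC [set: 'S_m]).

(* [p * q] applies p first, so in terms of composition of functions this is
   $b_\lambda a_\lambda = \sum_{p,q} \mathrm{sgn}(q)\, q \circ p$, encoded by
   its coordinate row in the group algebra. *)
Definition young_symmetrizer : 'rV[algC]_#|[set: 'S_m]| :=
  gring_row (\sum_(p in row_stab) \sum_(q in col_stab)
               (-1) ^+ q *: regS (p * q)%g).

(* Group elements act by right multiplication for [*], that is, by left
   composition: this is the left ideal $\mathbb{C}[S_m] b_\lambda a_\lambda$,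
   the Specht module spanned by the polytabloids. *)
Definition specht_repr :=
  submod_repr (cyclic_mx_module regS young_symmetrizer).

Definition chiS : 'CF([set: 'S_m]) := cfRepr specht_repr.

End Specht.

Definition kronecker (m : nat) (lam mu nu : seq nat) : algC :=
  '[chiS m lam * chiS m mu, chiS m nu].

Definition ceil_half (a : int) : int := Num.ceil (a%:~R / 2 : rat).

(* Main.v *)
Require Import Defs.
From mathcomp Require Import all_boot all_order all_fingroup all_algebra.
From mathcomp Require Import all_field all_character.
From mathcomp Require Import mpoly zify ring.
Set Implicit Arguments.
Unset Strict Implicit.
Unset Printing Implicit Defensive.
Import Order.TTheory GRing.Theory Num.Theory.
Local Open Scope ring_scope.

(* The inner product of chiS m lam with the character of a module M is the rank
   of the Young symmetrizer on M.  On the module of colourings 'I_m -> K with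
   prescribed colour counts, that rank is the dimension of the span of products
   of minors, one minor per column of lam, of a generic matrix whose rows are
   indexed by the rows of the diagram and whose columns are indexed by K.  When
   #|K| = 4, each column of length 4 contributes the full determinant, which can
   be cancelled in the polynomial ring.  Removing the lambda_3 columns of length
   4 therefore reduces the Kronecker coefficient to one for three two-row
   partitions of m - 4 lambda_3.

   A two-row character is a difference phi_b - phi_(b-1) of permutation
   characters on b-subsets, and <phi_b, phi_p phi_q> counts the 2 x 2 x 2
   contingency tables with the given margins (orbits of S_m on triples of
   subsets).  Writing the number of 2 x 2 tables with margins p, q as
   #{i | i <= p, q <= a - i} makes the second difference in p and q a count of
   pairs (i, j) with i + j <= q and i - j in an interval; the difference in b
   shifts that interval by one, so only its two end points survive. *)

(** * Characters of cyclic submodules of the regular module *)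

(** Write [A] as C R with C of full column rank and R of full row rank; idempotence forces R C = 1,
    and C R and R C have the same trace. *)
Lemma mxtrace_idem n (A : 'M[algC]_n) : A *m A = A -> \tr A = (\rank A)%:R.
Proof.
move=> idA; suff RC1: row_base A *m col_base A = 1%:M.
  by rewrite -[in LHS](mulmx_base A) mxtrace_mulC RC1 mxtrace1.
apply: (row_full_inj (col_base_full A)); apply: (row_free_inj (row_base_free A)).
rewrite mulmx1 -[RHS]/(col_base A *m row_base A).
by rewrite mulmxA mulmx_base -mulmxA mulmx_base idA.
Qed.

(** The hypotheses make [P] a projection onto [U], so [P *m rG x] maps everything into [U] and its
    trace is that of [x] on [U]. *)
Lemma cfRepr_submod_proj (gT : finGroupType) (G : {group gT}) n
    (rG : mx_representation algC G n) (U : 'M_n) (modU : mxmodule rG U) P x :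
    x \in G -> (P <= U)%MS -> U *m P = U ->
  cfRepr (submod_repr modU) x = \tr (P *m rG x).
Proof.
move=> Gx sPU UP; rewrite cfunE Gx mulr1n /= /submod_mx.
have -> : @val_submod _ _ U _ 1%:M = @val_submod _ _ U _ 1%:M *m P.
  have /submxP[D ->] : (@val_submod _ _ U _ 1%:M <= U)%MS by rewrite val_submodP.
  by rewrite -mulmxA UP.
rewrite in_submodE; set B := val_submod _; set C := in_submod _ 1%:M.
have -> : P *m rG x = P *m rG x *m C *m B.
  by rewrite /C -in_submodE /B -val_submodE in_submodK // mxmodule_trans.
clearbody B C.
by rewrite -!mulmxA mxtrace_mulC !mulmxA.
Qed.

Section CyclicCharacter.

Variables (gT : finGroupType) (G : {group gT}).
Local Notation aG := (regular_repr algC G).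

Lemma cfdot_cfRepr n (rG : mx_representation algC G n) (phi : 'CF(G)) :
  '[phi, cfRepr rG] =
    #|G|%:R^-1 * \sum_(x in G) phi x^-1%g * \tr (rG x).
Proof.
rewrite cfdotE (reindex_inj invg_inj) /=; congr (_ * _).
apply: eq_big => x; first by rewrite groupV.
rewrite groupV => Gx.
by rewrite -char_inv ?cfRepr_char // invgK cfunE Gx mulr1n.
Qed.

Lemma gring_mxE n (rG : mx_representation algC G n) (u : 'rV[algC]_#|G|) :
  gring_mx rG u = \sum_i u 0 i *: rG (enum_val i).
Proof.
rewrite /gring_mx /= mulmx_sum_row linear_sum; apply: eq_bigr => i _.
by rewrite linearZ /= rowK mxvecK.
Qed.

(** Take for u the [U]-component of 1 with respect to a complement [W]. For v in [U], the difference
    of u v and v lies in both [U] and [W], hence vanishes. *)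
Lemma gring_idem_of_submod (U : 'M[algC]_#|G|) :
    mxmodule aG U ->
  exists2 u : 'rV[algC]_#|G|, (u <= U)%MS &
    forall v : 'rV[algC]_#|G|, (v <= U)%MS -> u *m gring_mx aG v = v.
Proof.
move=> modU; have [W modW defUW /mxdirect_addsP dxUW] :=
  mx_Maschke_pchar aG (algC'G_pchar G) modU (submx1 _).
pose e : 'rV[algC]_#|G| := gring_row 1%:M.
have de : (e <= U + W)%MS by rewrite defUW submx1.
exists (e *m proj_mx U W); first exact: proj_mx_sub.
move=> v Uv; have defv : e *m gring_mx aG v = v.
  by rewrite -gring_row_mul mul1mx gring_mxK.
apply/eqP; rewrite -subr_eq0 -submx0 -dxUW sub_capmx.
have eU := proj_mx_sub U W e; have eW := proj_mx_compl_sub de.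
rewrite addmx_sub ?eqmx_opp ?(mxmodule_envelop modU (gring_mxP aG v) eU) //=.
rewrite -{2}defv -opprB eqmx_opp -mulmxBl.
exact: mxmodule_envelop modW (gring_mxP aG v) eW.
Qed.



Lemma mulmx_regular_repr (u : 'rV[algC]_#|G|) x y :
    x \in G -> y \in G ->
  (u *m aG y) 0 (gring_index G x) = u 0 (gring_index G (x * y^-1)%g).
Proof.
move=> Gx Gy; rewrite mxE (bigD1 (gring_index G (x * y^-1)%g)) //=.
rewrite mxE mxE gring_indexK ?groupM ?groupV // mulgKV !eqxx mulr1.
rewrite big1 ?addr0 // => i neq_i; rewrite !mxE /=.
case: eqP => [e | _]; last by rewrite mulr0.
case/eqP: neq_i; rewrite -[i]gring_valK; congr (gring_index G _).
have Gi := enum_valP i.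
by rewrite -[x](gring_indexK x Gx) e gring_indexK ?groupM ?mulgK.
Qed.

(* By Maschke the right ideal generated by v is also generated by an idempotent
   u; both sides are the trace of u on the module rG. *)
Lemma cfdot_cyclic_repr (v : 'rV[algC]_#|G|) n (rG : mx_representation algC G n) :
  '[cfRepr (submod_repr (cyclic_mx_module aG v)), cfRepr rG] =
    (\rank (gring_mx rG v))%:R.
Proof.
set U := cyclic_mx aG v.
have [u uU uid] := gring_idem_of_submod (cyclic_mx_module aG v).
have uu : gring_mx rG u *m gring_mx rG u = gring_mx rG u by rewrite -gring_mxA uid.
have -> : \rank (gring_mx rG v) = \rank (gring_mx rG u).
  apply/eqP; rewrite eqn_leq; apply/andP; split.
    by rewrite -[v in X in (X <= _)%N]uid ?cyclic_mx_id // gring_mxA mxrankM_maxl.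
  have /cyclic_mxP[A RA ->] := uU.
  by rewrite -[A]gring_rowK // gring_mxA mxrankM_maxl.
rewrite -mxtrace_idem //.
(* Left multiplication by [u]: it maps into [U] and fixes [U] pointwise. *)
pose P := \matrix_(i < #|G|) (u *m aG (enum_val i)).
have mulP (w : 'rV_#|G|) : w *m P = u *m gring_mx aG w.
  rewrite gring_mxE mulmx_sum_row mulmx_sumr; apply: eq_bigr => i _.
  by rewrite rowK -scalemxAr.
have sPU : (P <= U)%MS.
  by apply/row_subP=> i; rewrite rowK mxmodule_trans ?cyclic_mx_module ?enum_valP.
have UP : U *m P = U.
  by apply/row_matrixP=> i; rewrite row_mul mulP uid ?row_sub.
(* The diagonal entry at g of left multiplication by [u] followed by right multiplication by the
   inverse of [x] is the coefficient of [u] at a conjugate of [x]. Conjugating the summation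
   variable back, every g contributes the same trace, so the sum over g cancels 1 / |G|. *)
have chiE x : x \in G -> cfRepr (submod_repr (cyclic_mx_module aG v)) x^-1%g =
    \sum_(g in G) u 0 (gring_index G (x ^ g^-1)%g).
  move=> Gx; rewrite (cfRepr_submod_proj _ _ sPU) ?groupV // /mxtrace.
  rewrite [RHS]big_enum_val /=; apply: eq_bigr => i _.
  have Gi := enum_valP i.
  transitivity ((row i (P *m aG x^-1%g)) 0 i); first by rewrite [RHS]mxE.
  rewrite row_mul rowK -mulmxA -repr_mxM ?groupV // -{2}(gring_valK i).
  by rewrite mulmx_regular_repr ?groupM ?groupV // invMg invgK conjgE invgK mulgA.
rewrite cfdot_cfRepr; under eq_bigr => x Gx do rewrite chiE // mulr_suml.
rewrite exchange_big /=.
have trE g : g \in G -> \sum_(x in G) u 0 (gring_index G (x ^ g^-1)%g) * \tr (rG x) =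
    \tr (gring_mx rG u).
  move=> Gg; rewrite gring_mxE raddf_sum /= (reindex_inj (conjg_inj g)) /=.
  under eq_bigl => x do rewrite groupJr //.
  rewrite big_enum_val /=; apply: eq_bigr => i _.
  rewrite mxtraceZ conjgK gring_valK; congr (_ * _).
  have Gi := enum_valP i; rewrite conjgE !repr_mxM ?groupM ?groupV //.
  by rewrite mxtrace_mulC -!mulmxA -!repr_mxM ?groupM ?groupV // mulgV mulg1.
rewrite (eq_bigr _ trE) sumr_const -[_ *+ #|_|]mulr_natl mulrA mulVf ?mul1r //.
by rewrite pnatr_eq0 -lt0n cardG_gt0.
Qed.

End CyclicCharacter.

(** * Young symmetrizers acting on colourings *)

Lemma perm_of_perm_eq m (T : eqType) (h h' : 'I_m -> T) :
    perm_eq [seq h k | k <- enum 'I_m] [seq h' k | k <- enum 'I_m] ->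
  exists s : 'S_m, forall k, h (s k) = h' k.
Proof.
move=> hh'; have /tuple_permP[s Ds] : perm_eq [tuple h' k | k < m] [tuple h k | k < m].
  by rewrite perm_sym.
exists s => k; have := congr1 (fun t => nth (h k) t k) Ds.
by rewrite !nth_mktuple tnth_mktuple.
Qed.

Lemma perm_of_card m (T : finType) (h h' : 'I_m -> T) :
    (forall x, #|[set k | h k == x]| = #|[set k | h' k == x]|) ->
  exists s : 'S_m, forall k, h (s k) = h' k.
Proof.
move=> hh'; apply: perm_of_perm_eq; apply/allP => x _.
have e (u : 'I_m -> T) :
    count (preim u (pred1 x)) (enum 'I_m) = #|[set k | u k == x]|.
  rewrite -size_filter enumT cardsE cardE /enum_mem; congr size.
by rewrite /= count_map e count_map e hh'.
Qed.

Definition stab m (T : eqType) (h : 'I_m -> T) : {set 'S_m} :=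
  [set s : 'S_m | [forall k, h (s k) == h k]].

Lemma stabP m (T : eqType) (h : 'I_m -> T) (s : 'S_m) :
  reflect (forall k, h (s k) = h k) (s \in stab h).
Proof. by rewrite inE; apply: (iffP forallP) => hs k; apply/eqP; apply: hs. Qed.

(** * Permutation modules on colourings *)

Section ColouringModule.

Variables (m : nat) (K : finType).
Implicit Types (f g : {ffun 'I_m -> K}) (s t : 'S_m).

(** The inverse makes this a right action, in keeping with products of permutations that apply the
    left factor first. *)
Definition permf f s : {ffun 'I_m -> K} := [ffun k => f (s^-1%g k)].

Lemma permf1 f : permf f 1 = f.
Proof. by apply/ffunP=> k; rewrite ffunE invg1 perm1. Qed.

Lemma permfM f s t : permf f (s * t) = permf (permf f s) t.
Proof. by apply/ffunP=> k; rewrite !ffunE invMg permM. Qed.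

Lemma permfK s : cancel (permf^~ s) (permf^~ s^-1%g).
Proof. by move=> f; rewrite -permfM mulgV permf1. Qed.

Lemma permfKV s : cancel (permf^~ s^-1%g) (permf^~ s).
Proof. by move=> f; rewrite -permfM mulVg permf1. Qed.

Definition perm_closed (S : {set {ffun 'I_m -> K}}) :=
  forall f s, f \in S -> permf f s \in S.

Variables (S : {set {ffun 'I_m -> K}}) (clS : perm_closed S).

Definition colouring_mx s : 'M[algC]_#|S| :=
  \matrix_(i, j) (permf (enum_val i) s == enum_val j)%:R.

Lemma colouring_mx_repr : mx_repr [set: 'S_m] colouring_mx.
Proof.
split=> [|s t _ _]; apply/matrixP=> i j; rewrite !mxE.
  by rewrite permf1 (inj_eq enum_val_inj).
have Si := clS s (enum_valP i).
rewrite (bigD1 (enum_rank_in Si (permf (enum_val i) s))) //= big1 => [|k neq_k].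
  by rewrite !mxE enum_rankK_in // eqxx mul1r addr0 permfM.
rewrite !mxE; case: eqP => [e | _]; last by rewrite mul0r.
by case/eqP: neq_k; apply: enum_val_inj; rewrite enum_rankK_in.
Qed.

Definition colouring_repr := MxRepresentation colouring_mx_repr.

Definition colouring_cf := cfRepr colouring_repr.

Lemma colouring_cfE s : colouring_cf s = #|[set f in S | permf f s == f]|%:R.
Proof.
rewrite cfunE inE mulr1n /mxtrace; under eq_bigr do rewrite mxE.
rewrite -(big_enum_val (fun f => (permf f s == f)%:R)) /= -sum1_card natr_sum.
rewrite big_mkcond [RHS]big_mkcond; apply: eq_bigr => f _; rewrite [in RHS]inE.
by case: (f \in S) => //=; case: (_ == _).
Qed.

End ColouringModule.

(** Only the fibres of [ri] matter. Leaving its type free allows the rows to be labelled by the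
    colours themselves. *)
Definition young m (T : eqType) (ri : 'I_m -> T) (ci : 'I_m -> nat) :
    'rV[algC]_#|[set: 'S_m]| :=
  gring_row (\sum_(p in stab ri) \sum_(q in stab ci)
               (-1) ^+ q *: regular_repr algC [set: 'S_m] (p * q)%g).

(** * Products of minors attached to colourings of a diagram *)

Section TableauPolynomial.

Variables (m : nat) (T K : finType) (ri : 'I_m -> T) (ci : 'I_m -> nat).
Implicit Types (f g : {ffun 'I_m -> K}) (p q s : 'S_m).

Definition xvar (t : T) (x : K) : {mpoly algC[#|{: T * K}|]} :=
  'X_(enum_rank (t, x)).

(** The exponents record how often each colour occurs in each row: a complete invariant of the
    orbits of the row stabilizer on colourings. *)
Definition row_mon f : 'X_{1..#|{: T * K}|} :=
  (\sum_k U_(enum_rank (ri k, f k)))%MM.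

(* This matrix is block diagonal up to reordering, so its determinant is the
   product over the columns of the diagram of the corresponding minors. *)
Definition tabpoly f : {mpoly algC[#|{: T * K}|]} :=
  \det (\matrix_(k, l) ((ci k == ci l)%:R * xvar (ri k) (f l))).

Lemma row_monE f t x :
  row_mon f (enum_rank (t, x)) = #|[set k | (ri k, f k) == (t, x)]|.
Proof.
rewrite mnm_sumE -sum1dep_card [RHS]big_mkcond; apply: eq_bigr => k _ /=.
by rewrite mnm1E (inj_eq enum_rank_inj); case: (_ == _).
Qed.

Lemma row_mon_permf f p : p \in stab ri -> row_mon (permf f p) = row_mon f.
Proof.
move/stabP => hp; rewrite /row_mon [RHS](reindex_inj (@perm_inj _ p^-1%g)).
by apply: eq_bigr => k _; rewrite ffunE -{1}[k](permKV p) hp.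
Qed.

Lemma row_mon_eqP f g :
  reflect (exists2 p, p \in stab ri & permf f p = g) (row_mon f == row_mon g).
Proof.
apply: (iffP eqP) => [eq_fg | [p hp <-]]; last by rewrite row_mon_permf.
have [[t x]|s hs] := @perm_of_card m _ (fun k => (ri k, f k)) (fun k => (ri k, g k)).
  by rewrite -!row_monE eq_fg.
have hs1 k : ri (s k) = ri k by have [] := hs k.
exists s^-1%g; last first.
  by apply/ffunP=> k; rewrite ffunE invgK; have [] := hs k.
by apply/stabP=> k; rewrite -[in RHS](permKV s k) hs1.
Qed.

(** If some row permutation carries [f] to [g], all of them form a coset of the stabilizer of [f];
    by [row_mon_eqP] one exists exactly when the monomials agree. *)
Lemma card_row_transporter f g :
  #|[set p in stab ri | permf f p == g]| =
    (#|[set p in stab ri | permf f p == f]| * (row_mon g == row_mon f))%N.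
Proof.
rewrite eq_sym; have [/row_mon_eqP[p0 hp0 <-] | neq_fg] := boolP (row_mon f == _).
  rewrite muln1 -[RHS](card_imset _ (mulIg p0)).
  apply: eq_card => p; rewrite inE; apply/andP/imsetP => [[hp /eqP e] | [q]].
    exists (p * p0^-1)%g; rewrite ?mulgKV // inE permfM e permfK eqxx andbT.
    apply/stabP=> k; rewrite permM; have /stabP h0 := hp0; have /stabP h1 := hp.
    by rewrite -h0 permKV h1.
  rewrite inE => /andP[/stabP hq /eqP e] ->; rewrite permfM e eqxx; split => //.
  by apply/stabP=> k; rewrite permM; have /stabP -> := hp0; rewrite hq.
rewrite muln0; apply: eq_card0 => p; rewrite !inE; apply/negP => /andP[hp e].
case/negP: neq_fg; apply/row_mon_eqP; exists p; last exact/eqP.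
by rewrite inE.
Qed.

(** In the Leibniz expansion a permutation that moves a cell to another column contributes 0; the
    others form the column stabilizer. *)
Lemma tabpolyE f :
  tabpoly f = \sum_(q in stab ci) (-1) ^+ q *: 'X_[row_mon (permf f q^-1)].
Proof.
rewrite /tabpoly /determinant [RHS]big_mkcond; apply: eq_bigr => q _ /=.
under eq_bigr do rewrite mxE.
rewrite big_split /=; case: ifP => [/stabP hq | /negP hq].
  rewrite big1 => [|k _]; last by rewrite hq eqxx.
  rewrite mul1r /row_mon (big_morph _ (@mpolyXD _ _) (@mpolyX0 _ _)).
  rewrite -[RHS]mul_mpolyC rmorphXn rmorphN1; congr (_ * _).
  by apply: eq_bigr => k _; rewrite ffunE invgK.
have [k hk] : exists k, ci (q k) != ci k.
  apply/existsP; rewrite -negb_forall; apply/negP => h; case: hq.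
  by rewrite inE.
by rewrite (bigD1 k) //= eq_sym (negbTE hk) !mul0r mulr0.
Qed.

End TableauPolynomial.

(** * The Young symmetrizer as an operator on colourings *)

Section YoungOperator.

Variables (m : nat) (T K : finType) (ri : 'I_m -> T) (ci : 'I_m -> nat).
Variables (S : {set {ffun 'I_m -> K}}) (clS : perm_closed S).

Definition young_op : 'M_#|S| := gring_mx (colouring_repr clS) (young ri ci).

Lemma young_opE i j :
  young_op i j = \sum_(p in stab ri) \sum_(q in stab ci)
     (-1) ^+ q * (permf (enum_val i) (p * q) == enum_val j)%:R.
Proof.
rewrite /young_op /young -gring_opE linear_sum summxE; apply: eq_bigr => p _.
rewrite linear_sum summxE; apply: eq_bigr => q _.
by rewrite linearZ /= gring_opG ?inE // !mxE.
Qed.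

Lemma mcoeff_tabpoly_comb (c : 'rV_#|S|) mu :
  (\sum_i c 0 i *: tabpoly ri ci (enum_val i))@_mu =
    \sum_i c 0 i * \sum_(q in stab ci)
      (-1) ^+ q * (row_mon ri (permf (enum_val i) q^-1) == mu)%:R.
Proof.
rewrite raddf_sum; apply: eq_bigr => i _ /=; rewrite mcoeffZ tabpolyE raddf_sum.
by congr (_ * _); apply: eq_bigr => q _ /=; rewrite mcoeffZ mcoeffX.
Qed.

Lemma mulmx_young_op_tr (c : 'rV_#|S|) j :
  (c *m young_op^T) 0 j =
    #|[set p in stab ri | permf (enum_val j) p == enum_val j]|%:R *
    (\sum_i c 0 i *: tabpoly ri ci (enum_val i))@_(row_mon ri (enum_val j)).
Proof.
rewrite mcoeff_tabpoly_comb mulr_sumr mxE; apply: eq_bigr => i _.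
rewrite mulrCA mxE young_opE exchange_big /=; congr (_ * _); rewrite mulr_sumr.
apply: eq_bigr => q _; rewrite -mulr_sumr mulrCA; congr (_ * _).
rewrite -natrM -card_row_transporter -sum1_card natr_sum big_mkcond [RHS]big_mkcond.
apply: eq_bigr => p _; rewrite inE permfM (can2_eq (@permfK _ _ q) (@permfKV _ _ q)).
by case: (p \in _) => //=; case: (_ == _).
Qed.

(* Transposing makes the column antisymmetrizer act first; symmetrizing over the
   rows then amounts to replacing colourings by their monomials row_mon. *)
Lemma ker_young_op_tr (c : 'rV_#|S|) :
  c *m young_op^T = 0 <-> \sum_i c 0 i *: tabpoly ri ci (enum_val i) = 0.
Proof.
split=> [c0 | c0]; last by apply/rowP=> j; rewrite mulmx_young_op_tr c0 mcoeff0 mulr0 mxE.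
have coef0 f : f \in S -> (\sum_i c 0 i *: tabpoly ri ci (enum_val i))@_(row_mon ri f) = 0.
  move=> Sf; have /rowP/(_ (enum_rank_in Sf f)) := c0.
  rewrite mulmx_young_op_tr enum_rankK_in // [RHS]mxE => /eqP.
  (* The integer factor is nonzero, since the identity fixes every colouring. *)
  rewrite mulf_eq0 pnatr_eq0 cards_eq0 => /orP[/eqP/setP/(_ 1%g)|/eqP//].
  by rewrite !inE permf1 eqxx andbT => /forallP[]; move=> k; rewrite perm1.
apply/mpolyP => mu; rewrite mcoeff0.
have [/existsP[f /andP[Sf /eqP <-]] | /existsPn no_f] :=
  boolP [exists f, (f \in S) && (row_mon ri f == mu)]; first exact: coef0.
rewrite mcoeff_tabpoly_comb big1 // => i _; rewrite big1 ?mulr0 // => q _.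
have := no_f (permf (enum_val i) q^-1).
by rewrite clS ?enum_valP //= => /negbTE ->; rewrite mulr0.
Qed.

Lemma young_op_eq0 :
  (forall f, f \in S -> tabpoly ri ci f = 0) -> young_op = 0.
Proof.
move=> S0; apply: trmx_inj; rewrite trmx0; apply/row_matrixP=> i.
rewrite row0 rowE; apply/ker_young_op_tr; apply: big1 => j _.
by rewrite S0 ?scaler0 ?enum_valP.
Qed.

Lemma young_op_neq0 f : f \in S -> tabpoly ri ci f != 0 -> young_op != 0.
Proof.
move=> Sf; apply: contra => /eqP A0; apply/eqP.
have /ker_young_op_tr : delta_mx 0 (enum_rank_in Sf f) *m young_op^T = 0 :> 'rV_#|S|.
  by rewrite A0 trmx0 mulmx0.
rewrite (bigD1 (enum_rank_in Sf f)) //= big1 => [|i /negbTE ne].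
  by rewrite mxE !eqxx scale1r addr0 enum_rankK_in.
by rewrite mxE ne andbF scale0r.
Qed.

End YoungOperator.

Lemma eq_mxrank_of_ker (F : fieldType) m n p (A : 'M[F]_(m, n)) (B : 'M[F]_(m, p)) :
    (forall c : 'rV_m, c *m A = 0 <-> c *m B = 0) -> \rank A = \rank B.
Proof.
move=> kerAB; have eq_ker : (kermx A :=: kermx B)%MS.
  apply/eqmxP/andP; split; apply/rV_subP=> c /sub_kermxP c0;
    by apply/sub_kermxP; apply/kerAB.
have := mxrank_ker A; rewrite eq_ker mxrank_ker => e.
by rewrite -(subKn (rank_leq_row A)) -(subKn (rank_leq_row B)) e.
Qed.

(** * Two-row Specht characters *)

Section YoungNorm.

Variables (m : nat) (T : eqType) (ri : 'I_m -> T) (ci : 'I_m -> nat).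
Local Notation aG := (regular_repr algC [set: 'S_m]).

Definition row_sum : 'M[algC]_#|[set: 'S_m]| := \sum_(p in stab ri) aG p.
Definition col_sum : 'M[algC]_#|[set: 'S_m]| :=
  \sum_(q in stab ci) (-1) ^+ q *: aG q.

Lemma stabM (T' : eqType) (h : 'I_m -> T') s t :
  s \in stab h -> t \in stab h -> (s * t)%g \in stab h.
Proof. by move=> /stabP hs /stabP ht; apply/stabP=> k; rewrite permM ht hs. Qed.

Lemma stabV (T' : eqType) (h : 'I_m -> T') s :
  s \in stab h -> (s^-1)%g \in stab h.
Proof. by move=> /stabP hs; apply/stabP=> k; rewrite -[in RHS](permKV s k) hs. Qed.

Lemma mulmx_row_sum p : p \in stab ri -> aG p *m row_sum = row_sum.
Proof.
move=> hp; rewrite mulmx_sumr [RHS](reindex_inj (mulgI p)) /=.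
apply: eq_big => [q | q _]; last by rewrite repr_mxM ?inE.
apply/idP/idP => hq; first exact: stabM.
by rewrite -(mulKg p q) stabM ?stabV.
Qed.

Lemma mulmx_col_sum q : q \in stab ci -> col_sum *m aG q = (-1) ^+ q *: col_sum.
Proof.
move=> hq; rewrite mulmx_suml scaler_sumr.
rewrite [RHS](reindex_inj (mulIg q)) /=.
apply: eq_big => [s | s _].
  apply/idP/idP => hs; first exact: stabM.
  by rewrite -(mulgK q s) stabM ?stabV.
rewrite -scalemxAl -repr_mxM ?inE // scalerA; congr (_ *: _).
by rewrite odd_permM signr_addb mulrCA -signr_addb addbb mulr1.
Qed.

Lemma youngE : young ri ci = gring_row (row_sum *m col_sum).
Proof.
congr gring_row; rewrite mulmx_suml; apply: eq_bigr => p _.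
rewrite mulmx_sumr; apply: eq_bigr => q _.
by rewrite -scalemxAr -repr_mxM ?inE.
Qed.

Hypothesis row_col_dichotomy : forall g : 'S_m,
  (exists2 t, (t \in stab ci) && odd_perm t & (t ^ g)%g \in stab ri) \/
  (exists2 q, q \in stab ci & (q * g)%g \in stab ri).

(** In the first case t passes through [g] from the column side to the row side, which changes the
    sign of the product, so it is 0. In the second, [g] is a column permutation times a row
    permutation, and both are absorbed up to sign. *)
Lemma col_row_sum_multiple (g : 'S_m) :
  exists c, col_sum *m aG g *m row_sum = c *: (col_sum *m row_sum).
Proof.
case: (row_col_dichotomy g) => [[t /andP[ht odd_t] htg] | [q hq hqg]].
  exists 0; rewrite scale0r; set X := col_sum *m _ *m _.
  suff XN : X = - X.
    have : 2%:R *: X == 0 by rewrite scaler_nat mulr2n {1}XN addNr.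
    by rewrite scaler_eq0 pnatr_eq0 => /eqP.
  rewrite {1}/X -(mulmx_row_sum htg) -!mulmxA (mulmxA (aG g)) -repr_mxM ?inE //.
  rewrite -conjgC repr_mxM ?inE // !mulmxA mulmx_col_sum //.
  by rewrite odd_t expr1 scaleN1r !mulNmx.
exists ((-1) ^+ q); rewrite -{2}(mulmx_row_sum hqg) repr_mxM ?inE //.
rewrite !mulmxA (mulmx_col_sum hq) -!scalemxAl scalerA.
by rewrite -signr_addb addbb scale1r.
Qed.

(* The hypothesis gives b x a = c_x b a for all x (a, b the row and column sums),
   so the symmetrizer E = a b satisfies E x E = c_x E E. *)
Lemma cfnorm_young_le1 :
  '[cfRepr (submod_repr (cyclic_mx_module aG (young ri ci)))] <= 1.
Proof.
set U := cyclic_mx _ _; set rU := submod_repr _; set E := row_sum *m col_sum.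
have RE : (E \in group_ring algC [set: 'S_m])%MS.
  rewrite envelop_mxM ?linear_sum ?summx_sub // => g _ /=.
    by rewrite envelop_mx_id ?inE.
  by rewrite linearZ scalemx_sub ?envelop_mx_id ?inE.
rewrite cfdot_cyclic_repr -/rU.
have aE : gring_mx aG (young ri ci) = E by rewrite youngE gring_rowK.
set M := gring_mx rU _.
have valM : val_submod M = @val_submod _ _ U _ 1%:M *m E.
  rewrite -aE /M !gring_mxE linear_sum mulmx_sumr; apply: eq_bigr => i _ /=.
  rewrite linearZ -scalemxAr; congr (_ *: _).
  by rewrite -[rU _]mul1mx; apply: val_submodJ; apply: enum_valP.
(* Elements of the cyclic module have the form E X, and E X E is a multiple of E E, so the image
   lies on one line. *)
have sM : (val_submod M <= gring_row (E *m E))%MS.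
  rewrite valM; apply/row_subP=> i; rewrite row_mul.
  have /cyclic_mxP[X /envelop_mxP[x ->] ->] : (row i (@val_submod _ _ U _ 1%:M) <= U)%MS.
    by rewrite (submx_trans (row_sub _ _)) ?val_submodP.
  rewrite youngE -!gring_row_mul mulmx_sumr mulmx_suml linear_sum summx_sub //= => g _.
  rewrite -scalemxAr -scalemxAl linearZ scalemx_sub //=.
  have [c e] := col_row_sum_multiple g.
  have -> : E *m aG g *m E = c *: (E *m E).
    transitivity (row_sum *m (col_sum *m aG g *m row_sum) *m col_sum).
      by rewrite /E !mulmxA.
    by rewrite e -scalemxAr -scalemxAl /E !mulmxA.
  by rewrite linearZ scalemx_sub.
have -> : \rank M = \rank (val_submod M).
  by rewrite -{1}[M]val_submodK mxrank_in_submod ?val_submodP.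
by rewrite lern1 (leq_trans (mxrankS sM)) ?rank_leq_row.
Qed.

End YoungNorm.

(** * Cells of the diagram in row and column coordinates *)

Section Cells.

Variables (m : nat) (lam : seq nat) (sum_lam : sumn lam = m).

Definition rowi (k : 'I_m) : nat := reshape_index lam k.
Definition coli (k : 'I_m) : nat := reshape_offset lam k.

Lemma cell_inj k l : rowi k = rowi l -> coli k = coli l -> k = l.
Proof.
rewrite /rowi /coli => er ec; apply: val_inj => /=.
by rewrite -[LHS](reshape_indexK lam) er ec reshape_indexK.
Qed.

Lemma coli_lt k : (coli k < nth 0 lam (rowi k))%N.
Proof. by apply: reshape_offsetP; rewrite sum_lam. Qed.

Lemma cell_ex r c : (c < nth 0 lam r)%N -> exists k, rowi k = r /\ coli k = c.
Proof.
move=> lt_c; have lt_m := flatten_indexP lt_c; rewrite sum_lam in lt_m.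
exists (Ordinal lt_m); rewrite /rowi /coli /=.
by rewrite flatten_indexKl ?flatten_indexKr.
Qed.

Lemma young_symmetrizerE (T : eqType) (ri : 'I_m -> T) :
    (forall k l, (ri k == ri l) = (rowi k == rowi l)) ->
  young_symmetrizer m lam = young ri coli.
Proof.
move=> eq_ri; rewrite /young_symmetrizer; have -> : row_stab m lam = stab ri.
  by apply/setP=> s; rewrite !inE; apply: eq_forallb => k; rewrite eq_ri.
by [].
Qed.

Lemma cfdot_chiS_colouring (T K : finType) (ri : 'I_m -> T)
    (S : {set {ffun 'I_m -> K}}) (clS : perm_closed S) :
    (forall k l, (ri k == ri l) = (rowi k == rowi l)) ->
  '[chiS m lam, colouring_cf clS] = (\rank (young_op ri coli clS))%:R.
Proof.
move=> eq_ri; rewrite /chiS /specht_repr cfdot_cyclic_repr.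
by rewrite (young_symmetrizerE eq_ri).
Qed.

End Cells.

(** The columns of the matrix at [k] and [l] coincide. *)
Lemma tabpoly_eq0 m (T K : finType) (ri : 'I_m -> T) ci (f : {ffun 'I_m -> K}) k l :
  k != l -> ci k = ci l -> f k = f l -> tabpoly ri ci f = 0.
Proof.
move=> neq_kl eq_c eq_f; rewrite /tabpoly -det_tr.
by apply: (determinant_alternate neq_kl) => i; rewrite !mxE eq_c eq_f.
Qed.

(** The point at which the generic matrix becomes the identity matrix; evaluating there shows that
    determinants are nonzero. *)
Definition diag_eval (T : finType) (i : 'I_#|{: T * T}|) : algC :=
  ((enum_val i).1 == (enum_val i).2)%:R.

Lemma meval_xvar (T : finType) (t x : T) :
  meval (@diag_eval T) (xvar t x) = (t == x)%:R.
Proof. by rewrite mevalXU /diag_eval enum_rankK. Qed.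

Lemma tabpoly_row_neq0 m (T : finType) (ri : 'I_m -> T) ci :
    (forall k l, ri k = ri l -> ci k = ci l -> k = l) ->
  tabpoly ri ci (finfun ri) != 0.
Proof.
move=> inj_cell; apply/eqP => /(congr1 (meval (@diag_eval T))).
rewrite rmorph0 /tabpoly -det_map_mx; set A := map_mx _ _.
have -> : A = 1%:M.
  apply/matrixP=> k l; rewrite !mxE rmorphM rmorph_nat /= meval_xvar ffunE -natrM mulnb.
  congr (_%:R); have [-> | neq_kl] := eqVneq k l; first by rewrite !eqxx.
  apply/eqP; rewrite eqb0; apply: contra neq_kl => /andP[/eqP ec /eqP er].
  by apply/eqP; apply: inj_cell.
by rewrite det1 => /eqP; rewrite oner_eq0.
Qed.

Section Weights.

Variables (m : nat) (K : finType).
Implicit Types (f : {ffun 'I_m -> K}) (A : pred K).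

(** Integer-valued, so that the level z - 1 makes sense at z = 0, where the level set is empty. *)
Definition wt A f : int := #|[set k | A (f k)]|%:Z.

Lemma wt_permf A f s : wt A (permf f s) = wt A f.
Proof.
rewrite /wt; congr (Posz _); rewrite -(card_preimset [set k | A (f k)] (@perm_inj _ s^-1%g)).
by apply: eq_card => k; rewrite !inE ffunE.
Qed.

End Weights.

Section LevelSets.

Variables (m : nat) (z : int).

Definition level_set : {set {ffun 'I_m -> bool}} := [set f | wt id f == z].

Lemma level_set_closed : perm_closed level_set.
Proof. by move=> f s; rewrite !inE wt_permf. Qed.

Definition phi := colouring_cf level_set_closed.

End LevelSets.

Section TwoRows.

Variables (m : nat) (lam : seq nat).
Local Notation a := (nth 0%N lam 0).
Local Notation b := (nth 0%N lam 1).
Hypothesis sum_lam : sumn lam = m.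
Hypothesis lam_ge2 : forall r, (2 <= r)%N -> nth 0%N lam r = 0%N.
Hypothesis leba : (b <= a)%N.
Local Notation ci := (@coli m lam).

Definition rowb (k : 'I_m) : bool := rowi lam k == 1%N.

Lemma rowi_bool k : rowi lam k = rowb k.
Proof.
rewrite /rowb; case: (rowi lam k) (coli_lt sum_lam k) => [|[|r]] //=.
by rewrite lam_ge2.
Qed.

Lemma eq_rowb k l : (rowb k == rowb l) = (rowi lam k == rowi lam l).
Proof. by rewrite !rowi_bool; case: (rowb k); case: (rowb l). Qed.

Lemma rowb_cell_inj k l : rowb k = rowb l -> ci k = ci l -> k = l.
Proof. by move=> er; apply: cell_inj; apply/eqP; rewrite -eq_rowb er. Qed.

Lemma rowb_cell_ex (r : bool) c :
  (c < nth 0 lam r)%N -> exists k, rowb k = r /\ ci k = c.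
Proof.
move=> /(cell_ex sum_lam)[k [rk ck]]; exists k; split=> //.
by move: rk; rewrite rowi_bool; case: (rowb k) r => [] [].
Qed.

Lemma card_rowb : #|[set k | rowb k]| = b.
Proof.
have uniq_c : uniq [seq ci k | k in [set k | rowb k]].
  rewrite map_inj_in_uniq ?enum_uniq // => k l.
  by rewrite !mem_enum !inE => rk rl; apply: rowb_cell_inj; rewrite rk rl.
rewrite cardE -(size_map ci) -(size_iota 0 b); apply/perm_size/uniq_perm => //.
  exact: iota_uniq.
move=> c; rewrite mem_iota add0n /=; apply/imageP/idP => [[k] | ltcb].
  by rewrite inE => rk ->; have := coli_lt sum_lam k; rewrite rowi_bool rk.
by have [k [rk ck]] := @rowb_cell_ex true c ltcb; exists k; rewrite ?inE.
Qed.

(** Each of the first b columns has two cells; their values differ, so one of them is true. *)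
Lemma card_true_ge (f : 'I_m -> bool) :
    (forall k l, ci k = ci l -> f k = f l -> k = l) ->
  (b <= #|[set k | f k & (ci k < b)%N]|)%N.
Proof.
move=> inj_f; rewrite cardE -(size_map ci) -{1}(size_iota 0 b).
apply: uniq_leq_size => [|c]; first exact: iota_uniq.
rewrite mem_iota add0n /= => ltcb.
have [k [rk ck]] := @rowb_cell_ex true c ltcb.
have [l [rl cl]] := @rowb_cell_ex false c (leq_trans ltcb leba).
have [fk | nfk] := boolP (f k).
  by apply/imageP; exists k; rewrite // inE fk ck.
apply/imageP; exists l; rewrite // inE cl ltcb andbT; apply: contraNT nfk => nfl.
have := inj_f k l; rewrite ck cl (negbTE nfl) => /(_ erefl).
by case: (f k) => // /(_ erefl) e; move: rk; rewrite e rl.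
Qed.

(** Give each cell the row of its image under [g]. If two cells of one column agree, their
    transposition is the required t. Otherwise the b columns of length 2 hold one true cell each,
    which exhausts the true cells, so a column permutation restores the original rows. *)
Lemma two_row_dichotomy (g : 'S_m) :
  (exists2 t, (t \in stab ci) && odd_perm t & (t ^ g)%g \in stab rowb) \/
  (exists2 q, q \in stab ci & (q * g)%g \in stab rowb).
Proof.
pose f k := rowb (g k).
have [/existsP[k /existsP[l /and3P[neq_kl /eqP ec /eqP ef]]] | inj_f] :=
  boolP [exists k, exists l, [&& k != l, ci k == ci l & f k == f l]].
  left; exists (tperm k l); last first.
    apply/stabP=> i; rewrite tpermJ.
    by case: tpermP => [-> | -> | //]; rewrite [LHS]/(f _) ?ef.
  rewrite odd_tperm neq_kl andbT; apply/stabP=> i.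
  by case: tpermP => [-> | -> | //].
right; have {}inj_f k l : ci k = ci l -> f k = f l -> k = l.
  move=> ec ef; apply/eqP; apply: contraNT inj_f => neq_kl.
  by apply/existsP; exists k; apply/existsP; exists l; rewrite neq_kl ec ef !eqxx.
have card_f : #|[set k | f k]| = b.
  rewrite -card_rowb -(card_preimset [set k | rowb k] (@perm_inj _ g)).
  by apply: eq_card => k; rewrite !inE.
have f_lt k : f k -> (ci k < b)%N.
  have /eqP e : [set k | f k & (ci k < b)%N] == [set k | f k].
    rewrite eqEcard card_f card_true_ge // andbT.
    by apply/subsetP=> i; rewrite !inE => /andP[].
  by move=> fk; have /setP/(_ k) := e; rewrite !inE fk.
have [|q hq] := @perm_of_perm_eq m _ (fun k => (ci k, f k)) (fun k => (ci k, rowb k)).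
  have uniq_h (h : 'I_m -> bool) : (forall k l, ci k = ci l -> h k = h l -> k = l) ->
      uniq [seq (ci k, h k) | k <- enum 'I_m].
    by move=> inj_h; rewrite map_inj_uniq ?enum_uniq // => k l []; apply: inj_h.
  have uf := uniq_h f inj_f; have ur := uniq_h rowb (fun k l e e' => rowb_cell_inj e' e).
  apply: uniq_perm => //; apply: (uniq_min_size uf _ _).2; last by rewrite !size_map.
  move=> _ /mapP[k _ ->].
  have [|l [rl cl]] := @rowb_cell_ex (f k) (ci k).
    case: (boolP (f k)) => [/f_lt // | nfk]; have := coli_lt sum_lam k.
    by rewrite rowi_bool; case: (rowb k) => // /leq_trans->.
  by apply/mapP; exists l; rewrite ?mem_enum // rl cl.
exists q; apply/stabP=> k; first by have [] := hq k.
by rewrite permM; have [_] := hq k.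
Qed.

(** The Specht character pairs to 0 with phi_(b-1), because a colouring with b - 1 true cells
    repeats a value in some column, and to at least 1 with phi_b, because the colouring by rows has
    a nonzero polynomial. Both characters having norm at most 1, they coincide. *)
Lemma chiS_two_rows_of_norm :
  '[phi m b%:Z - phi m (b%:Z - 1)] = 1 ->
  chiS m lam = phi m b%:Z - phi m (b%:Z - 1).
Proof.
set psi := _ - _ => norm_psi; set chi := chiS m lam.
have norm_chi : '[chi] <= 1.
  rewrite /chi /chiS /specht_repr (young_symmetrizerE eq_rowb).
  exact: cfnorm_young_le1 two_row_dichotomy.
have chi_phi0 : '[chi, phi m (b%:Z - 1)] = 0.
  rewrite (cfdot_chiS_colouring _ eq_rowb) young_op_eq0 ?mxrank0 // => f.
  rewrite inE => /eqP eq_f.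
  have lt_f : (#|[set k | f k]| < b)%N.
    by have : #|[set k | f k]|%:Z = b%:Z - 1 := eq_f; lia.
  have [/existsP[k /existsP[l /and3P[neq_kl /eqP ec /eqP ef]]] | inj_f] :=
    boolP [exists k, exists l, [&& k != l, ci k == ci l & f k == f l]].
    exact: tabpoly_eq0 neq_kl ec ef.
  suff le_f : (b <= #|[set k | f k]|)%N by rewrite ltnNge le_f in lt_f.
  apply: leq_trans (@card_true_ge f _) _; last first.
    by apply: subset_leq_card; apply/subsetP=> i; rewrite !inE => /andP[].
  move=> k l ec ef; apply/eqP; apply: contraNT inj_f => neq_kl.
  by apply/existsP; exists k; apply/existsP; exists l; rewrite neq_kl ec ef !eqxx.
have chi_phi1 : '[chi, phi m b%:Z] >= 1.
  rewrite (cfdot_chiS_colouring _ eq_rowb) ler1n lt0n mxrank_eq0.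
  apply: (@young_op_neq0 _ _ _ _ _ _ _ (finfun rowb)).
    rewrite inE /wt -card_rowb; apply/eqP; congr (Posz _).
    by apply: eq_card => k; rewrite !inE ffunE.
  exact/tabpoly_row_neq0/rowb_cell_inj.
have chi_psi : '[chi, psi] >= 1 by rewrite cfdotBr chi_phi0 subr0.
have psi_chi : '[psi, chi] >= 1.
  by rewrite cfdotC -conjC1 -(geC0_conj (le_trans ler01 chi_psi)) conjCK conjC1.
clearbody psi.
(* |chi - psi|^2 <= 1 - 1 - 1 + 1 = 0 *)
apply/eqP; rewrite -subr_eq0 -cfnorm_eq0 eq_le cfnorm_ge0 andbT.
rewrite cfdotBl !cfdotBr norm_psi subr_le0 (@le_trans _ _ 0) //.
  by rewrite subr_le0 (le_trans norm_chi).
by rewrite subr_ge0.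
Qed.

End TwoRows.

(** * Removing columns of full length *)

Lemma det_reindex (R : comNzRingType) n (A : 'M[R]_n) (h : 'S_n) :
  \det (\matrix_(k, l) A (h k) (h l)) = \det A.
Proof.
have -> : \matrix_(k, l) A (h k) (h l) = row_perm h (col_perm h A).
  by apply/matrixP=> k l; rewrite !mxE.
rewrite row_permE col_permE !det_mulmx !det_perm odd_permV mulrCA.
by rewrite -signr_addb addbb mulr1.
Qed.

Lemma card_set_split n1 n2 (P : pred 'I_(n1 + n2)) :
  #|[set k | P k]| =
    (#|[set i | P (lshift n2 i)]| + #|[set j | P (rshift n1 j)]|)%N.
Proof. by rewrite -!sum1dep_card big_mkcond big_split_ord /= -!big_mkcond. Qed.

Section FullColumns.

Variables (K : finType) (c m' : nat).
Local Notation n1 := #|{: K * 'I_c}|.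
Local Notation m := (n1 + m')%N.
Variables (lam lam' : seq nat).
Hypotheses (sum_lam : sumn lam = m) (sum_lam' : sumn lam' = m').
(** These match rows with colours, so each of the c columns to be removed has one cell per colour
    and its minor is the full determinant. *)
Variables (u : nat -> K) (v : K -> nat).
Hypothesis uK : cancel v u.
Hypothesis vK : forall r, (0 < nth 0 lam r)%N -> v (u r) = r.
Hypothesis lamE : forall x, nth 0%N lam (v x) = (c + nth 0 lam' (v x))%N.
Hypothesis lam'_le : forall r, (nth 0 lam' r <= nth 0 lam r)%N.

Local Notation ri := (fun k => u (@rowi m lam k)).
Local Notation ri' := (fun k => u (@rowi m' lam' k)).
Local Notation ci := (@coli m lam).
Local Notation ci' := (@coli m' lam').

Lemma vK_rowi k : v (u (@rowi m lam k)) = @rowi m lam k.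
Proof. by apply: vK; apply: leq_trans (coli_lt sum_lam k). Qed.

Lemma vK_rowi' k : v (u (@rowi m' lam' k)) = @rowi m' lam' k.
Proof.
by apply: vK; apply: leq_trans (lam'_le _); apply: leq_trans (coli_lt sum_lam' k).
Qed.

Lemma eq_ri k l :
  (u (@rowi m lam k) == u (@rowi m lam l)) = (@rowi m lam k == @rowi m lam l).
Proof.
by apply/eqP/eqP => [/(congr1 v) | -> //]; rewrite !vK_rowi.
Qed.

Lemma eq_ri' k l :
  (u (@rowi m' lam' k) == u (@rowi m' lam' l)) = (@rowi m' lam' k == @rowi m' lam' l).
Proof.
by apply/eqP/eqP => [/(congr1 v) | -> //]; rewrite !vK_rowi'.
Qed.

(** Lists the cells of [lam] with the full columns first, then those of [lam'] shifted right by c;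
    the row-by-row numbering interleaves the two, hence the reindexing [h]. *)
Definition split_cell (k : 'I_m) : K * nat :=
  match split k with
  | inl i => ((enum_val i).1, nat_of_ord (enum_val i).2)
  | inr j => (ri' j, c + ci' j)%N
  end.

Lemma split_cell_lshift i :
  split_cell (lshift m' i) = ((enum_val i).1, nat_of_ord (enum_val i).2).
Proof. by rewrite /split_cell (unsplitK (inl i)). Qed.

Lemma split_cell_rshift j : split_cell (rshift n1 j) = (ri' j, c + ci' j)%N.
Proof. by rewrite /split_cell (unsplitK (inr j)). Qed.

Lemma split_cell_inj : injective split_cell.
Proof.
move=> k l; rewrite -(splitK k) -(splitK l).
case: (split k) (split l) => [i | j] [i' | j'] /=;
  rewrite ?split_cell_lshift ?split_cell_rshift.
- case=> e1 /val_inj e2; congr lshift; apply: enum_val_inj.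
  by case: (enum_val i) (enum_val i') e1 e2 => ? ? [? ?] /= -> ->.
- by case=> _ e; have := ltn_ord (enum_val i).2; rewrite e ltnNge leq_addr.
- by case=> _ e; have := ltn_ord (enum_val i').2; rewrite -e ltnNge leq_addr.
case=> /eqP; rewrite eq_ri' => /eqP er /addnI ec.
by rewrite (cell_inj er ec).
Qed.

Lemma split_cell_perm : exists h : 'S_m, forall k, (ri (h k), ci (h k)) = split_cell k.
Proof.
apply: (@perm_of_perm_eq m _ (fun k => (ri k, ci k)) split_cell).
rewrite perm_sym.
have uniq_t : uniq [seq split_cell k | k <- enum 'I_m].
  by rewrite map_inj_uniq ?enum_uniq //; apply: split_cell_inj.
apply: uniq_perm => //.
  rewrite map_inj_uniq ?enum_uniq // => k l [/eqP + ec].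
  by rewrite eq_ri => /eqP er; apply: cell_inj er ec.
apply: (uniq_min_size uniq_t _ _).2; last by rewrite !size_map.
move=> _ /mapP[k _ ->]; rewrite -(splitK k).
have cell_in x j : (j < nth 0 lam (v x))%N ->
    (x, j) \in [seq (ri k, ci k) | k <- enum 'I_m].
  case/(cell_ex sum_lam) => l [rl cl]; apply/mapP; exists l; rewrite ?mem_enum //.
  by rewrite /= rl cl uK.
case: (split k) => [i | j] /=; rewrite ?split_cell_lshift ?split_cell_rshift.
  by apply: cell_in; rewrite lamE ltn_addr.
by apply: cell_in; rewrite lamE ltn_add2l vK_rowi'; apply: coli_lt.
Qed.

Variable h : 'S_m.
Hypothesis hE : forall k, (ri (h k), ci (h k)) = split_cell k.
Implicit Type f : {ffun 'I_m -> K}.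

Definition restr f : {ffun 'I_m' -> K} := [ffun j => f (h (rshift n1 j))].

(* The block of the matrix of tabpoly f on the full columns factors as
   full_mx *m fill_mx f, which confines the dependence on f to scalars. *)
Definition fill_mx f : 'M[algC]_n1 :=
  \matrix_(i, j) (enum_val i == (f (h (lshift m' j)), (enum_val j).2))%:R.

Definition full_mx : 'M[{mpoly algC[#|{: K * K}|]}]_n1 :=
  \matrix_(i, j) (((enum_val i).2 == (enum_val j).2)%:R *
                    xvar (enum_val i).1 (enum_val j).1).

Lemma det_full_mx_neq0 : \det full_mx != 0.
Proof.
apply/eqP => /(congr1 (meval (@diag_eval K))); rewrite rmorph0 -det_map_mx.
set A := map_mx _ _; have -> : A = 1%:M; last by rewrite det1 => /eqP; rewrite oner_eq0.
apply/matrixP=> i j; rewrite !mxE rmorphM rmorph_nat /= meval_xvar -natrM mulnb.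
rewrite -(inj_eq enum_val_inj); case: (enum_val i) (enum_val j) => [x k] [y l] /=.
by rewrite xpair_eqE andbC.
Qed.

(** The two groups of cells share no column, so after reindexing by [h] the matrix is block
    diagonal. *)
Lemma tabpoly_split f :
  tabpoly ri ci f =
    \det full_mx * (\det (fill_mx f))%:MP * tabpoly ri' ci' (restr f).
Proof.
rewrite /tabpoly -(det_reindex _ h).
have riE k : u (rowi lam (h k)) = (split_cell k).1 by rewrite -hE.
have ciE k : ci (h k) = (split_cell k).2 by rewrite -hE.
set B := \matrix_(k, l) _.
have -> : B = block_mx (full_mx *m map_mx (@mpolyC _ algC) (fill_mx f)) 0 0
   (\matrix_(k, l) ((ci' k == ci' l)%:R * xvar (ri' k) (restr f l))).
  apply/matrixP=> k l; rewrite -(splitK k) -(splitK l).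
  case: (split k) (split l) => [i | j] [i' | j'] /=.
  - rewrite block_mxEul !mxE riE !ciE !split_cell_lshift /=.
    rewrite (bigD1 (enum_rank (f (h (lshift m' i')), (enum_val i').2))) //=.
    rewrite big1 => [|l' neq_l']; last first.
      rewrite !mxE (can2_eq enum_valK enum_rankK) (negbTE neq_l').
      by rewrite [X in _ * X]mpolyC0 mulr0.
    by rewrite !mxE !enum_rankK /= eqxx [X in _ * X + _]mpolyC1 mulr1 addr0.
  - rewrite block_mxEur !mxE !ciE split_cell_lshift split_cell_rshift /=.
    by rewrite ltn_eqF ?mul0r // ltn_addr.
  - rewrite block_mxEdl !mxE !ciE split_cell_lshift split_cell_rshift /=.
    by rewrite gtn_eqF ?mul0r // ltn_addr.
  rewrite block_mxEdr !mxE riE !ciE !split_cell_rshift /= eqn_add2l.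
  by rewrite ffunE.
by rewrite det_ublock det_mulmx det_map_mx.
Qed.

Lemma fill_mx_id f :
  (forall i, f (h (lshift m' i)) = (enum_val i).1) -> \det (fill_mx f) = 1.
Proof.
move=> hf; rewrite -[RHS](det1 _ n1); congr (\det _); apply/matrixP=> i j.
by rewrite !mxE hf -surjective_pairing (inj_eq enum_val_inj).
Qed.

(** A nonzero determinant has no zero row, so the map [F] below is onto, hence bijective: each full
    column shows every colour exactly once. *)
Lemma wt_restr (A : pred K) f :
  \det (fill_mx f) != 0 -> wt A f = (#|A| * c)%N%:Z + wt A (restr f).
Proof.
move=> nz; pose F (j : 'I_n1) := (f (h (lshift m' j)), (enum_val j).2).
have F_onto y : y \in codom F.
  apply: contraNT nz => not_y; rewrite (expand_det_row _ (enum_rank y)) big1 // => j _.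
  rewrite mxE enum_rankK; case: eqP => [e | _]; last by rewrite mul0r.
  by case/negP: not_y; rewrite e; apply: codom_f.
have F_inj : injective F.
  have /image_injP inj_F : #|image F predT| == #|(predT : pred 'I_n1)|.
    rewrite [X in _ == X](_ : _ = n1); last by rewrite -[RHS]card_ord; apply: eq_card.
    by apply/eqP; apply: eq_card => y; rewrite F_onto.
  by move=> i j; apply: inj_F.
have F_bij : bijective F by apply: inj_card_bij => //; rewrite card_ord.
have cardF : #|[set j | A (F j).1]| = (#|A| * c)%N.
  transitivity #|setX [set x | A x] [set: 'I_c]|.
    rewrite -[RHS](on_card_preimset (onW_bij _ F_bij)).
    by apply: eq_card => j; rewrite !inE andbT.
  by rewrite cardsX cardsT card_ord cardsE.
rewrite /wt -PoszD -cardF; congr (Posz _).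
rewrite -(card_preimset [set k | A (f k)] (@perm_inj _ h)).
transitivity #|[set k | A (f (h k))]|; first by apply: eq_card => k; rewrite !inE.
rewrite (card_set_split (fun k => A (f (h k)))); congr (_ + _)%N.
by apply: eq_card => j; rewrite !inE ffunE.
Qed.

Section RankTransfer.

Variables (S : {set {ffun 'I_m -> K}}) (S' : {set {ffun 'I_m' -> K}}).
Variables (clS : perm_closed S) (clS' : perm_closed S').
Hypothesis restrS : forall f, \det (fill_mx f) != 0 -> (f \in S) = (restr f \in S').

(** By [tabpoly_split], [P] carries combinations of the polynomials of [S] to combinations of those
    of [S'], up to the nonzero factor [\det full_mx]. The relations therefore correspond, and
    composing with [P], which has full rank, keeps the rank. *)
Lemma mxrank_young_op_restr :
  \rank (young_op ri ci clS) = \rank (young_op ri' ci' clS').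
Proof.
pose P := \matrix_(i < #|S|, j < #|S'|)
  (\det (fill_mx (enum_val i)) * (restr (enum_val i) == enum_val j)%:R).
rewrite -mxrank_tr -[RHS]mxrank_tr.
have fullP : row_full P.
  (* Colouring each cell of the full columns by its own row extends [g] with determinant 1; this
     yields a left inverse of [P]. *)
  pose ext (g : {ffun 'I_m' -> K}) : {ffun 'I_m -> K} := [ffun k =>
    match split (h^-1%g k) with inl i => (enum_val i).1 | inr j => g j end].
  have ext_l g i : ext g (h (lshift m' i)) = (enum_val i).1.
    by rewrite ffunE permK (unsplitK (inl i)).
  have restr_ext g : restr (ext g) = g.
    by apply/ffunP=> j; rewrite !ffunE permK (unsplitK (inr j)).
  have det_ext g : \det (fill_mx (ext g)) = 1 by apply: fill_mx_id => i.
  apply/row_fullP; exists (\matrix_(j, i) (ext (enum_val j) == enum_val i)%:R).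
  apply/matrixP=> j j'; rewrite !mxE.
  have Sj : ext (enum_val j) \in S.
    by rewrite restrS ?det_ext ?oner_eq0 // restr_ext enum_valP.
  rewrite (bigD1 (enum_rank_in Sj (ext (enum_val j)))) //= big1 => [|i neq_i].
    rewrite !mxE enum_rankK_in // eqxx det_ext restr_ext !mul1r addr0.
    by rewrite (inj_eq enum_val_inj).
  rewrite !mxE; case: eqP => [e | _]; last by rewrite mul0r.
  by case/eqP: neq_i; apply: enum_val_inj; rewrite enum_rankK_in.
rewrite -(eqmxMfull (young_op ri' ci' clS')^T fullP).
apply: eq_mxrank_of_ker => c0; rewrite mulmxA.
suff e : \sum_i c0 0 i *: tabpoly ri ci (enum_val i) = \det full_mx *
           \sum_j (c0 *m P) 0 j *: tabpoly ri' ci' (enum_val j).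
  split=> [/ker_young_op_tr/eqP | /ker_young_op_tr] e0.
    apply/ker_young_op_tr/eqP; move: e0.
    by rewrite e mulf_eq0 (negbTE det_full_mx_neq0).
  by apply/ker_young_op_tr; rewrite e e0 mulr0.
rewrite mulr_sumr; under [RHS]eq_bigr => j _.
  rewrite mxE scaler_suml mulr_sumr. over.
rewrite exchange_big /=; apply: eq_bigr => i _.
rewrite tabpoly_split; have [det0 | nz] := eqVneq (\det (fill_mx (enum_val i))) 0.
  rewrite det0 mpolyC0 mulr0 mul0r scaler0 big1 // => j _.
  by rewrite mxE det0 mul0r mulr0 scale0r mulr0.
have Si : restr (enum_val i) \in S' by rewrite -restrS ?enum_valP.
rewrite (bigD1 (enum_rank_in Si (restr (enum_val i)))) //= big1 => [|j neq_j].
  rewrite mxE enum_rankK_in // eqxx mulr1 addr0 -scalerA -scalerAr; congr (_ *: _).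
  by rewrite -mulrA mul_mpolyC.
rewrite mxE; case: eqP => [e | _]; last by rewrite !mulr0 scale0r mulr0.
by case/eqP: neq_j; apply: enum_val_inj; rewrite enum_rankK_in.
Qed.

End RankTransfer.

End FullColumns.

(** * Counting contingency tables *)

Lemma count_interval N (lo hi : int) : 0 <= lo -> hi < N%:Z ->
  (\sum_(t < N) (lo <= t%:Z <= hi)%R)%N%:Z = Num.max 0 (hi - lo + 1).
Proof.
move=> lo0; suff e n : (\sum_(t < n) (lo <= t%:Z <= hi)%R)%N%:Z =
    Num.max 0 (Num.min hi (n%:Z - 1) - lo + 1) by rewrite e; lia.
elim: n => [|n IHn]; first by rewrite big_ord0; lia.
by rewrite big_ord_recr /= PoszD IHn; lia.
Qed.

Section Counting.

Variable m : nat.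
Local Notation N := m.+1.
Implicit Types (a b p q z : int).

(** Counts 2 x 2 tables of total a with margins p and q by their corner entry t; the other entries
    are p - t, q - t and a - p - q + t. *)
Definition ntables a p q : nat :=
  \sum_(t < N) [&& t%:Z <= p, t%:Z <= q & p + q <= a + t%:Z]%R.

(* The symmetric form separates p from q, so that sums over splittings of p and
   of q factor in ntriplesE. *)
Definition ntables_sym a p q : nat :=
  \sum_(i < N) ([&& i%:Z <= p & p + i%:Z <= a]%R * [&& i%:Z <= q & q + i%:Z <= a]%R).

(** Both sides are lengths of intervals, and min(p, q) - max(0, p + q - a) = min(p, q, a - p, a -
    q). *)
Lemma ntablesE a p q : p <= m%:Z -> q <= m%:Z -> ntables a p q = ntables_sym a p q.
Proof.
move=> lepm leqm; apply/eqP; rewrite -eqz_nat; apply/eqP.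
transitivity (Num.max 0 (Num.min p q - Num.max 0 (p + q - a) + 1)).
  rewrite -(@count_interval N); [congr (Posz _)|lia|lia].
  by apply: eq_bigr => t _; congr nat_of_bool; lia.
transitivity (Num.max 0 (Num.min (Num.min p q) (Num.min (a - p) (a - q)) - 0 + 1)); first lia.
rewrite -(@count_interval N); [congr (Posz _)|lia|lia].
by apply: eq_bigr => t _; rewrite mulnb; congr nat_of_bool; lia.
Qed.

(** Counts 2 x 2 x 2 tables of total m with margins b, p, q: [p1] and [q1] are the margins of the
    slice of total m - b. *)
Definition ntriples b p q : nat :=
  \sum_(p1 < N) \sum_(q1 < N)
     ntables (m%:Z - b)%R p1%:Z q1%:Z * ntables b (p - p1%:Z)%R (q - q1%:Z)%R.

(** Counts the ways to divide the margin z between the two slices, for fixed indices i, j of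
    [ntables_sym] in each. *)
Definition nsplit b (i j : nat) z : nat :=
  \sum_(p1 < N) ([&& i%:Z <= p1%:Z & p1%:Z + i%:Z <= m%:Z - b]%R *
                 [&& j%:Z <= z - p1%:Z & z - p1%:Z + j%:Z <= b]%R).

Lemma ntriplesE b p q : p <= m%:Z -> q <= m%:Z ->
  ntriples b p q = (\sum_(i < N) \sum_(j < N) nsplit b i j p * nsplit b i j q)%N.
Proof.
move=> lepm leqm; rewrite /nsplit.
under [RHS]eq_bigr => i _ do under eq_bigr => j _ do rewrite big_distrlr /=.
under [RHS]eq_bigr => i _ do rewrite exchange_big /=.
rewrite exchange_big /=; apply: eq_bigr => p1 _.
under [RHS]eq_bigr => i _ do rewrite exchange_big /=.
rewrite exchange_big /=; apply: eq_bigr => q1 _.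
have := ltn_ord p1; have := ltn_ord q1 => ltq1 ltp1.
rewrite !ntablesE; [|lia..].
rewrite big_distrlr /=; apply: eq_bigr => i _; apply: eq_bigr => j _.
by rewrite -!mulnA; congr (_ * _)%N; rewrite mulnCA.
Qed.

(** The count is the length of [max(i, z + j - b), min(m - b - i, z - j)]. From z - 1 to z each end
    moves by at most one, and 2 z <= m prevents a nonempty interval from shrinking. *)
Lemma nsplit_diff b i j z : 2 * z <= m%:Z ->
  (nsplit b i j z)%:Z - (nsplit b i j (z - 1))%:Z =
    [&& i%:Z + j%:Z <= z, z + i%:Z <= m%:Z - b + j%:Z & z + j%:Z <= b + i%:Z].
Proof.
move=> le2zm; have E z' : z' <= m%:Z -> (nsplit b i j z')%:Z =
  Num.max 0 (Num.min (m%:Z - b - i%:Z) (z' - j%:Z) - Num.max i%:Z (z' + j%:Z - b) + 1).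
  move=> lez'; rewrite -(@count_interval N); [congr (Posz _)|lia|lia].
  by apply: eq_bigr => t _; rewrite mulnb; congr nat_of_bool; lia.
by rewrite !E; lia.
Qed.

Definition nline (d q : int) : nat :=
  \sum_(i < N) \sum_(j < N) [&& i%:Z + j%:Z <= q & i%:Z == j%:Z + d]%R.

Lemma nline_opp d q : nline (- d) q = nline d q.
Proof.
rewrite /nline exchange_big /=; apply: eq_bigr => i _; apply: eq_bigr => j _.
by congr nat_of_bool; lia.
Qed.

(** The pair is determined by j, which runs from 0 to floor((q - d) / 2); the bounds on 2 n express
    this count without division. *)
Lemma nlineE d q : 0 <= d -> q <= m%:Z ->
  let n := (nline d q)%:Z in
  if d <= q then q - d + 1 <= 2 * n <= q - d + 2 else n == 0.
Proof.
move=> d0 leqm /=; pose h := ((q - d) %/ 2)%Z.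
have -> : nline d q = (\sum_(j < N) (0 <= j%:Z <= h)%R)%N.
  rewrite /nline exchange_big; apply: eq_bigr => j _ /=.
  apply/eqP; rewrite -eqz_nat; apply/eqP.
  transitivity (Num.max 0 (Num.min (j%:Z + d) (q - j%:Z) - (j%:Z + d) + 1)); last first.
    by rewrite /h; lia.
  rewrite -(@count_interval N); [congr (Posz _)|lia|lia].
  by apply: eq_bigr => i _; congr nat_of_bool; lia.
by rewrite count_interval; rewrite /h; [case: ifP|..]; lia.
Qed.

Lemma ntriplesZ b p q : p <= m%:Z -> q <= m%:Z ->
  (ntriples b p q)%:Z =
    \sum_(i < N) \sum_(j < N) (nsplit b i j p)%:Z * (nsplit b i j q)%:Z.
Proof.
move=> lepm leqm; rewrite ntriplesE // (big_morph Posz PoszD (erefl _)).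
apply: eq_bigr => i _; rewrite (big_morph Posz PoszD (erefl _)).
by apply: eq_bigr => j _; rewrite PoszM.
Qed.

(** Each summand is a function of p times a function of q, so two indicators get multiplied; as q <=
    p, the bound on i + j comes from q and the other two from p. *)
Lemma ntriples_diff2 b p q : q <= p -> 2 * p <= m%:Z ->
  (ntriples b p q)%:Z - (ntriples b (p - 1) q)%:Z
    - ((ntriples b p (q - 1))%:Z - (ntriples b (p - 1) (q - 1))%:Z) =
  \sum_(i < N) \sum_(j < N)
    ([&& i%:Z + j%:Z <= q, p + i%:Z <= m%:Z - b + j%:Z & p + j%:Z <= b + i%:Z])%:Z.
Proof.
move=> leqp le2p; rewrite !ntriplesZ; [|lia..].
rewrite -!sumrB; apply: eq_bigr => i _; rewrite -!sumrB; apply: eq_bigr => j _.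
rewrite -!mulrBl -mulrBr !nsplit_diff; [|lia..].
by rewrite -PoszM mulnb; congr (Posz _); congr nat_of_bool; lia.
Qed.

(** At b, i - j ranges over [p - b, m - b - p], nonempty as 2 p <= m; at b - 1 this interval moves
    up by one. *)
Lemma ntriples_diff3 b p q : q <= p -> 2 * p <= m%:Z ->
  let D b' := (ntriples b' p q)%:Z - (ntriples b' (p - 1) q)%:Z
    - ((ntriples b' p (q - 1))%:Z - (ntriples b' (p - 1) (q - 1))%:Z) in
  D b - D (b - 1) = (nline (p - b) q)%:Z - (nline (m%:Z - b - p + 1) q)%:Z.
Proof.
move=> leqp le2p /=; rewrite !ntriples_diff2 // /nline.
rewrite !(big_morph Posz PoszD (erefl _)) -!sumrB; apply: eq_bigr => i _.
rewrite !(big_morph Posz PoszD (erefl _)) -!sumrB; apply: eq_bigr => j _.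
by lia.
Qed.

End Counting.

Lemma ceil_half_bounds x : x <= 2 * ceil_half x <= x + 1.
Proof.
have := ceil_itv (x%:~R / 2 : rat); rewrite -/(ceil_half x).
have -> : 2 = 2%:~R :> rat by [].
rewrite ltr_pdivlMr ?ltr0z // ler_pdivrMr ?ltr0z // -!intrM ltr_int ler_int.
by lia.
Qed.

Lemma nline_ceil_half m d q : (0 <= d)%R -> q <= m%:Z ->
  (nline m d q)%:Z = Num.max 0 (ceil_half (q - d + 1)).
Proof.
move=> d0 leqm; have := ceil_half_bounds (q - d + 1).
by have /= := nlineE d0 leqm; case: ifP; lia.
Qed.

(** * Orbits on colourings *)

Section Orbits.

Variables (m : nat) (K : finType) (I : finType).
Variables (S : {set {ffun 'I_m -> K}}) (clS : perm_closed S).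
Variable inv : {ffun 'I_m -> K} -> I.
Hypothesis inv_permf : forall f s, inv (permf f s) = inv f.
Hypothesis inv_complete : forall f g, f \in S -> g \in S ->
  inv f = inv g -> exists s, permf f s = g.

(** Burnside's count, with orbits named by the complete invariant [inv]. Within an orbit, the
    stabilizer of f is a translate of the set of permutations carrying a base point to f, and these
    sets partition the group. *)
Lemma sum_fixed_colourings :
  (\sum_(s : 'S_m) #|[set f in S | permf f s == f]| =
     #|inv @: S| * #|[set: 'S_m]|)%N.
Proof.
transitivity (\sum_(f in S) #|[set s : 'S_m | permf f s == f]|)%N.
  transitivity (\sum_(s : 'S_m) \sum_(f in S) (permf f s == f))%N.
    apply: eq_bigr => s _; rewrite -sum1_card big_mkcond [RHS]big_mkcond.
    by apply: eq_bigr => f _; rewrite inE; case: (f \in S) => //=; case: eqP.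
  rewrite exchange_big; apply: eq_bigr => f Sf /=.
  by rewrite -sum1dep_card [RHS]big_mkcond.
rewrite (partition_big_imset inv) /= -sum_nat_const; apply: eq_bigr => y.
case/imsetP=> f0 Sf0 ->{y}.
transitivity (\sum_(f in S | inv f == inv f0) #|[set s : 'S_m | permf f0 s == f]|)%N.
  apply: eq_bigr => f /andP[Sf /eqP ef].
  have [s0 <-] := inv_complete Sf0 Sf (esym ef).
  rewrite -(card_imset [set s | permf (permf f0 s0) s == _] (mulgI s0)).
  apply: eq_card => s; rewrite inE; apply/imsetP/eqP => [[t] | e].
    by rewrite inE -permfM => /eqP e ->.
  by exists (s0^-1 * s)%g; rewrite ?mulKVg // inE -permfM mulKVg e.
transitivity (\sum_(f in S | inv f == inv f0) \sum_(s : 'S_m) (permf f0 s == f))%N.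
  by apply: eq_bigr => f _; rewrite -sum1dep_card [LHS]big_mkcond.
rewrite exchange_big /= -sum1_card; apply: eq_big => [s | s _]; first by rewrite inE.
rewrite (bigD1 (permf f0 s)) ?clS ?inv_permf ?eqxx //= big1 ?addn0 // => f.
by case/andP=> _ /negbTE; rewrite eq_sym => ->.
Qed.

Lemma cfdot_colouring_1 : '[colouring_cf clS, 1] = #|inv @: S|%:R.
Proof.
rewrite cfdotE; under eq_bigr => s _ do
  rewrite colouring_cfE cfun1E inE conjC1 mulr1.
rewrite (eq_bigl predT) => [|s]; last by rewrite inE.
rewrite -natr_sum sum_fixed_colourings natrM mulrC mulfK //.
by rewrite pnatr_eq0 -lt0n cardG_gt0.
Qed.

End Orbits.

(** * Products of permutation characters *)

Section PairColourings.

Variables (m : nat) (K1 K2 : finType).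
Variables (S1 : {set {ffun 'I_m -> K1}}) (S2 : {set {ffun 'I_m -> K2}}).
Variables (clS1 : perm_closed S1) (clS2 : perm_closed S2).

Definition fst_col (f : {ffun 'I_m -> K1 * K2}) : {ffun 'I_m -> K1} :=
  [ffun k => (f k).1].
Definition snd_col (f : {ffun 'I_m -> K1 * K2}) : {ffun 'I_m -> K2} :=
  [ffun k => (f k).2].

Definition pair_set : {set {ffun 'I_m -> K1 * K2}} :=
  [set f | (fst_col f \in S1) && (snd_col f \in S2)].

Lemma fst_col_permf f s : fst_col (permf f s) = permf (fst_col f) s.
Proof. by apply/ffunP=> k; rewrite !ffunE. Qed.

Lemma snd_col_permf f s : snd_col (permf f s) = permf (snd_col f) s.
Proof. by apply/ffunP=> k; rewrite !ffunE. Qed.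

Lemma pair_set_closed : perm_closed pair_set.
Proof.
move=> f s; rewrite !inE fst_col_permf snd_col_permf => /andP[h1 h2].
by rewrite clS1 ?clS2.
Qed.

Lemma colouring_cf_pair :
  colouring_cf clS1 * colouring_cf clS2 = colouring_cf pair_set_closed.
Proof.
apply/cfunP=> s; rewrite cfunE !colouring_cfE -natrM -cardsX; congr (_%:R).
pose zipf (fg : {ffun 'I_m -> K1} * {ffun 'I_m -> K2}) : {ffun 'I_m -> K1 * K2} :=
  [ffun k => (fg.1 k, fg.2 k)].
have zip1 fg : fst_col (zipf fg) = fg.1 by apply/ffunP=> k; rewrite !ffunE.
have zip2 fg : snd_col (zipf fg) = fg.2 by apply/ffunP=> k; rewrite !ffunE.
have zipK f : zipf (fst_col f, snd_col f) = f.
  by apply/ffunP=> k; rewrite !ffunE -surjective_pairing.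
have zip_inj : injective zipf.
  move=> fg fg' e; rewrite [fg]surjective_pairing -zip1 -zip2 e.
  by rewrite zip1 zip2 -surjective_pairing.
rewrite -(card_imset _ zip_inj); apply: eq_card => f; rewrite [RHS]inE.
apply/imsetP/andP => [[[g1 g2]] | [Sf /eqP fixf]].
  rewrite !inE /= => /andP[/andP[S1g /eqP e1] /andP[S2g /eqP e2]] ->.
  rewrite zip1 zip2 S1g S2g; split=> //; apply/eqP.
  by rewrite -[LHS]zipK fst_col_permf snd_col_permf zip1 zip2 /= e1 e2.
exists (fst_col f, snd_col f); rewrite ?zipK // !inE /=.
by move: Sf; rewrite inE -fst_col_permf -snd_col_permf fixf !eqxx !andbT.
Qed.

End PairColourings.

Lemma exists_colouring m (K : finType) (x0 : K) (n : K -> nat) :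
  (\sum_x n x)%N = m ->
  exists f : {ffun 'I_m -> K}, forall x, #|[set k | f k == x]| = n x.
Proof.
move=> sum_n; pose s := flatten [seq nseq (n x) x | x <- enum K].
have size_s : size s = m.
  rewrite size_flatten /shape -map_comp sumnE big_map big_enum -sum_n.
  by apply: eq_bigr => x _ /=; rewrite size_nseq.
exists [ffun k : 'I_m => nth x0 s k] => x.
have -> : n x = count_mem x s.
  rewrite count_flatten -map_comp sumnE big_map big_enum (bigD1 x) //=.
  rewrite count_nseq /= eqxx mul1n big1 ?addn0 // => y /negbTE neq_y.
  by rewrite count_nseq /= neq_y.
rewrite -[in count_mem x s](mkseq_nth x0 s) size_s /mkseq count_map.
rewrite -val_enum_ord count_map -size_filter enumT cardsE cardE /enum_mem.
by congr size; apply: eq_filter => k /=; rewrite [in LHS]unfold_in /= ffunE.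
Qed.

Lemma cfdot_mul_real (gT : finGroupType) (G : {group gT}) (chi psi theta : 'CF(G)) :
  (forall x, (psi x)^* = psi x) -> '[chi * psi, theta] = '[chi, psi * theta].
Proof.
move=> psi_real; rewrite !cfdotE; congr (_ * _); apply: eq_bigr => x _.
by rewrite !cfunE rmorphM /= psi_real mulrA.
Qed.

Lemma big_pair (A B : finType) (F : A * B -> nat) :
  (\sum_t F t = \sum_a \sum_b F (a, b))%N.
Proof. by rewrite pair_bigA; apply: eq_bigr => [] []. Qed.

(** * Orbits on triples of subsets *)

Section TripleCount.

Variables (m : nat).
Local Notation N := m.+1.
Local Notation K3 := (bool * (bool * bool))%type.
Implicit Type f : {ffun 'I_m -> K3}.

(** The eight entries of the contingency table of a triple of subsets. *)
Definition cls f (x y z : bool) : nat := #|[set k | f k == (x, (y, z))]|.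

Lemma card_cls f (A : bool -> bool -> bool -> bool) :
  #|[set k | A (f k).1 (f k).2.1 (f k).2.2]| =
    (\sum_(x : bool) \sum_(y : bool) \sum_(z : bool) A x y z * cls f x y z)%N.
Proof.
transitivity (\sum_(t : K3) A t.1 t.2.1 t.2.2 * #|[set k | f k == t]|)%N.
  rewrite -sum1dep_card (partition_big f predT) //=; apply: eq_bigr => t _.
  rewrite -sum1dep_card big_distrr /= big_mkcond [RHS]big_mkcond.
  apply: eq_bigr => k _; have [-> | ] := eqVneq (f k) t; last by rewrite andbF.
  by rewrite andbT; case: (A _ _ _).
by rewrite big_pair; apply: eq_bigr => x _; rewrite big_pair.
Qed.

Lemma cls_total f :
  (cls f true true true + cls f true true false + cls f true false true
   + cls f true false false + cls f false true true + cls f false true false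
   + cls f false false true + cls f false false false = m)%N.
Proof.
have := card_cls f (fun _ _ _ => true); rewrite !big_bool /= !mul1n => e.
rewrite -[RHS]card_ord -cardsT -(_ : [set k | true] = [set: 'I_m]); last first.
  by apply/setP=> k; rewrite !inE.
rewrite e; lia.
Qed.

Definition triple_set (b p q : int) : {set {ffun 'I_m -> K3}} :=
  pair_set (level_set m b) (pair_set (level_set m p) (level_set m q)).

Lemma mem_triple_set b p q f : (f \in triple_set b p q) =
  [&& (cls f true true true + cls f true true false + cls f true false true
        + cls f true false false)%N%:Z == b,
      (cls f true true true + cls f true true false + cls f false true true
        + cls f false true false)%N%:Z == p &
      (cls f true true true + cls f true false true + cls f false true true
        + cls f false false true)%N%:Z == q].
Proof.
rewrite !inE /wt.
have -> : [set k | id (fst_col f k)] = [set k | (f k).1].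
  by apply/setP=> k; rewrite !inE ffunE.
have -> : [set k | id (fst_col (snd_col f) k)] = [set k | (f k).2.1].
  by apply/setP=> k; rewrite !inE !ffunE.
have -> : [set k | id (snd_col (snd_col f) k)] = [set k | (f k).2.2].
  by apply/setP=> k; rewrite !inE !ffunE.
rewrite (card_cls f (fun x _ _ => x)) (card_cls f (fun _ y _ => y)).
by rewrite (card_cls f (fun _ _ z => z)) !big_bool /=; lia.
Qed.

(** With the total and three margins fixed, four of the eight entries are free; these coordinates
    are the summation indices of [ntriples]. Each is at most m, so [inord] loses nothing. *)
Definition triple_inv f : ('I_N * 'I_N) * ('I_N * 'I_N) :=
  ((inord (cls f false true true + cls f false true false),
    inord (cls f false true true + cls f false false true)),
   (inord (cls f false true true), inord (cls f true true true))).

Lemma triple_inv_permf f s : triple_inv (permf f s) = triple_inv f.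
Proof.
have e x y z : cls (permf f s) x y z = cls f x y z.
  rewrite /cls -(card_preimset [set k | f k == _] (@perm_inj _ s^-1%g)).
  by apply: eq_card => k; rewrite !inE ffunE.
by rewrite /triple_inv !e.
Qed.

Lemma triple_inv_complete b p q f g :
    f \in triple_set b p q -> g \in triple_set b p q ->
  triple_inv f = triple_inv g -> exists s, permf f s = g.
Proof.
rewrite !mem_triple_set => /and3P[/eqP f1 /eqP f2 /eqP f3].
case/and3P=> /eqP g1 /eqP g2 /eqP g3.
have totf := cls_total f; have totg := cls_total g.
case=> /(congr1 val) e1 /(congr1 val) e2 /(congr1 val) e3 /(congr1 val) e4.
rewrite /= !inordK in e1 e2 e3 e4; [|lia..].
have [x|s hs] := @perm_of_card m _ f g.
  by case: x => [[] [[] []]]; rewrite -!/(cls _ _ _ _); lia.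
by exists s^-1%g; apply/ffunP=> k; rewrite ffunE invgK.
Qed.

Lemma card_triple_inv b p q : p <= m%:Z -> q <= m%:Z ->
  #|triple_inv @: triple_set b p q| = ntriples m b p q.
Proof.
move=> lepm leqm.
pose P (y : ('I_N * 'I_N) * ('I_N * 'I_N)) :=
  [&& y.2.1%:Z <= y.1.1%:Z, y.2.1%:Z <= y.1.2%:Z
    & y.1.1%:Z + y.1.2%:Z <= m%:Z - b + y.2.1%:Z] &&
  [&& y.2.2%:Z <= p - y.1.1%:Z, y.2.2%:Z <= q - y.1.2%:Z
    & (p - y.1.1%:Z) + (q - y.1.2%:Z) <= b + y.2.2%:Z].
have -> : triple_inv @: triple_set b p q = [set y | P y].
  apply/setP=> y; rewrite inE; apply/imsetP/idP => [[f] | Py].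
    rewrite mem_triple_set => /and3P[/eqP f1 /eqP f2 /eqP f3] ->.
    have totf := cls_total f.
    by rewrite /P /triple_inv /= !inordK; lia.
  case: y Py => [[p1 q1] [t t']]; rewrite /P /= => Py.
  (* The table rebuilt from its four coordinates; [P] makes every argument of [absz] nonnegative. *)
  pose n (x : K3) : nat := match x with
    | (true, (true, true)) => t'
    | (true, (true, false)) => absz (p - p1%:Z - t'%:Z)%R
    | (true, (false, true)) => absz (q - q1%:Z - t'%:Z)%R
    | (true, (false, false)) => absz (b + t'%:Z - (p - p1%:Z) - (q - q1%:Z))%R
    | (false, (true, true)) => t
    | (false, (true, false)) => (p1 - t)%N
    | (false, (false, true)) => (q1 - t)%N
    | (false, (false, false)) => absz (m%:Z - b + t%:Z - p1%:Z - q1%:Z)%R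
    end.
  have [|f hf] := @exists_colouring m _ (true, (true, true)) n.
    by rewrite big_pair !big_bool /= !big_pair !big_bool /=; lia.
  have hc x y z : cls f x y z = n (x, (y, z)) by apply: hf.
  have lt1 := ltn_ord p1; have lt2 := ltn_ord q1; have lt3 := ltn_ord t.
  have lt4 := ltn_ord t'.
  exists f; first by rewrite mem_triple_set !hc /n; lia.
  rewrite /triple_inv !hc /n; congr ((_, _), (_, _)); apply: val_inj;
    rewrite /= inordK; lia.
rewrite -sum1dep_card big_mkcond /= 2!big_pair.
apply: eq_bigr => p1 _; apply: eq_bigr => q1 _; rewrite big_pair.
rewrite /ntables big_distrlr /=; apply: eq_bigr => t _; apply: eq_bigr => t' _.
by rewrite mulnb.
Qed.

Lemma cfdot_phi3 b p q : p <= m%:Z -> q <= m%:Z ->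
  '[phi m b, phi m p * phi m q] = (ntriples m b p q)%:R.
Proof.
move=> lepm leqm; rewrite -[X in '[_, X]]mulr1 -cfdot_mul_real; last first.
  by move=> s; rewrite cfunE !colouring_cfE -natrM conjC_nat.
rewrite /phi !colouring_cf_pair.
rewrite (@cfdot_colouring_1 _ _ _ _ _ triple_inv triple_inv_permf).
  by rewrite card_triple_inv.
exact: triple_inv_complete.
Qed.

End TripleCount.

(** * Kronecker coefficients *)

Definition psi m z := phi m z - phi m (z - 1).

Lemma phi_real m z s : (phi m z s)^* = phi m z s.
Proof. by rewrite colouring_cfE conjC_nat. Qed.

Lemma psiE m z s : psi m z s = phi m z s - phi m (z - 1) s.
Proof. by rewrite cfunE [X in _ + X]cfunE. Qed.

Lemma psi_real m z s : (psi m z s)^* = psi m z s.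
Proof. by rewrite psiE rmorphB /= !phi_real. Qed.

Lemma cfdot_psi3 m b p q : q <= p -> 2 * p <= m%:Z ->
  '[psi m b, psi m p * psi m q] =
    ((nline m (p - b) q)%:Z - (nline m (m%:Z - b - p + 1) q)%:Z)%:~R.
Proof.
move=> leqp le2p; rewrite -ntriples_diff3 // /psi.
rewrite mulrBl !mulrBr !cfdotBl !cfdotBr !cfdot_phi3; [|lia..].
rewrite !rmorphB /= !pmulrn; ring.
Qed.

Lemma psi0 m : psi m 0 = 1.
Proof.
apply/cfunP=> s; rewrite psiE cfun1E inE /phi !colouring_cfE.
rewrite (_ : [set f in level_set m (0 - 1) | _] = set0) ?cards0 ?subr0; last first.
  by apply/setP=> f; rewrite !inE /wt; case: eqP => // e; lia.
rewrite (_ : [set f in _ | _] = [set [ffun=> false]]) ?cards1 //.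
apply/setP=> f; rewrite !inE /wt; apply/andP/eqP => [[/eqP wt0 _] | ->].
  apply/ffunP=> k; rewrite ffunE; apply: negbTE; apply/negP => fk.
  have : (0 < #|[set k | id (f k)]|)%N by apply/card_gt0P; exists k; rewrite inE.
  by case: wt0 => ->.
split; last by apply/eqP/ffunP=> k; rewrite !ffunE.
by apply/eqP; congr Posz; apply: eq_card0 => k; rewrite !inE ffunE.
Qed.

(** The norm is the pairing of psi_0 = 1 with the square of psi_b, hence a difference of line
    counts: one pair on i - j = b with i + j <= b, and none on i - j = m - b + 1, which exceeds
    b. *)
Lemma cfnorm_psi m (b : nat) : (2 * b <= m)%N -> '[psi m b%:Z] = 1.
Proof.
move=> le2b; rewrite -[X in '[X, _]]mul1r cfdot_mul_real; last exact: psi_real.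
rewrite -psi0 cfdot_psi3; [|lia..].
rewrite subr0 (_ : _ - _ = 1) //.
have := @nlineE m b%:Z b%:Z; have := @nlineE m (m%:Z - 0 - b%:Z + 1) b%:Z.
move=> /(_ _ _) /= h1 /(_ _ _) /= h2.
have {}h1 := h1 ltac:(lia) ltac:(lia); have {}h2 := h2 ltac:(lia) ltac:(lia).
move: h1 h2; rewrite subr0 lexx; case: ifP => [|_ /eqP ->]; first by lia.
lia.
Qed.

Lemma chiS_two_rows m lam : sumn lam = m ->
    (forall r, (2 <= r)%N -> nth 0%N lam r = 0%N) ->
    (nth 0 lam 1 <= nth 0 lam 0)%N -> (2 * nth 0 lam 1 <= m)%N ->
  chiS m lam = psi m (nth 0%N lam 1)%:Z.
Proof.
move=> sum_lam lam_ge2 leba le2b.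
by apply: chiS_two_rows_of_norm => //; apply: cfnorm_psi.
Qed.

Lemma card_fst_bool2 : #|(fun x : bool * bool => x.1)| = 2%N.
Proof. by rewrite -sum1_card big_mkcond big_pair !big_bool. Qed.

Lemma card_snd_bool2 : #|(fun x : bool * bool => x.2)| = 2%N.
Proof. by rewrite -sum1_card big_mkcond big_pair !big_bool. Qed.

(** Rows are numbered in binary by the four colours. A full column shows each colour once, so it has
    two cells with true first coordinate and two with true second: each level drops by 2 c. *)
Lemma cfdot_chiS_remove_columns (c m' : nat) (lam lam' : seq nat)
    (m := (#|{: bool * bool * 'I_c}| + m')%N) (p q : int) :
    sumn lam = m -> sumn lam' = m' ->
    (forall r, (r < 4)%N -> nth 0%N lam r = (c + nth 0 lam' r)%N) ->
    (forall r, (4 <= r)%N -> nth 0%N lam r = 0%N /\ nth 0%N lam' r = 0%N) ->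
  '[chiS m lam, phi m p * phi m q] =
    '[chiS m' lam', phi m' (p - (2 * c)%N%:Z) * phi m' (q - (2 * c)%N%:Z)].
Proof.
move=> sum_lam sum_lam' lam_lt4 lam_ge4.
pose u r := nth (false, false)
  [:: (false, false); (false, true); (true, false); (true, true)] r.
pose v (x : bool * bool) : nat := (2 * x.1 + x.2)%N.
have v_lt4 x : (v x < 4)%N by case: x => [] [] [].
have uK : cancel v u by case=> [] [] [].
have vK r : (0 < nth 0 lam r)%N -> v (u r) = r.
  by case: r => [|[|[|[|r]]]] //; rewrite (lam_ge4 _ _).1.
have lamE x : nth 0%N lam (v x) = (c + nth 0 lam' (v x))%N by rewrite lam_lt4.
have lam'_le r : (nth 0 lam' r <= nth 0 lam r)%N.
  by have [/lam_lt4-> | /lam_ge4[_ ->] //] := ltnP r 4; rewrite leq_addl.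
have [h hE] := split_cell_perm sum_lam sum_lam' uK vK lamE lam'_le.
rewrite /phi !colouring_cf_pair.
rewrite (cfdot_chiS_colouring _ (eq_ri sum_lam vK)).
rewrite (cfdot_chiS_colouring _ (eq_ri' sum_lam' vK lam'_le)).
congr (_%:R); apply: (mxrank_young_op_restr hE) => f nz.
rewrite !inE.
have fstE n (g : {ffun 'I_n -> bool * bool}) : wt id (fst_col g) = wt (fun x => x.1) g.
  by congr Posz; apply: eq_card => k; rewrite !inE ffunE.
have sndE n (g : {ffun 'I_n -> bool * bool}) : wt id (snd_col g) = wt (fun x => x.2) g.
  by congr Posz; apply: eq_card => k; rewrite !inE ffunE.
rewrite !fstE !sndE !(wt_restr _ nz) card_fst_bool2 card_snd_bool2.
by congr andb; lia.
Qed.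

Lemma nth_gt0_plength lam r :
  sorted geq lam -> (0 < nth 0 lam r)%N = (r < plength lam)%N.
Proof.
elim: lam r => [|a s IHs] r; first by rewrite nth_nil.
move=> sorted_as; have sorted_s := path_sorted sorted_as.
have geq_trans : transitive geq by move=> y x z xy yz; apply: leq_trans yz xy.
have /allP le_a := order_path_min geq_trans sorted_as.
rewrite {1}/plength /= -/(plength s).
case: a le_a {sorted_as} => [|a] le_a; last by case: r => //= r; rewrite IHs.
have s0 : plength s = 0%N.
  apply/eqP; rewrite /plength eqn0Ngt -has_count.
  by apply/hasPn => x /le_a; rewrite /= -leqNgt.
by rewrite add0n s0; case: r => //= r; rewrite IHs ?s0.
Qed.

Lemma sumn_nth lam n : (forall r, (n <= r)%N -> nth 0%N lam r = 0%N) ->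
  sumn lam = (\sum_(i < n) nth 0 lam i)%N.
Proof.
elim: lam n => [|a s IHs] [|n] lam0.
- by rewrite big_ord0.
- by rewrite big1 // => i _; rewrite nth_nil.
- rewrite big_ord0 /= (IHs 0%N) ?big_ord0 => [|r _]; first by have /= -> := lam0 0%N.
  exact: (lam0 r.+1).
rewrite big_ord_recl /=; congr (_ + _)%N; apply: IHs => r le_nr.
exact: (lam0 r.+1).
Qed.

Lemma nth_partition_le lam i j :
  sorted geq lam -> (i <= j)%N -> (nth 0 lam j <= nth 0 lam i)%N.
Proof.
move=> sorted_lam le_ij; have [lt_j | /(nth_default 0%N) -> //] := ltnP j (size lam).
apply: (@sorted_leq_nth _ geq _ _ 0%N lam) => //; rewrite ?inE //.
- by move=> y x z xy yz; apply: leq_trans yz xy.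
- exact: leqnn.
- exact: leq_ltn_trans le_ij lt_j.
Qed.

Theorem theorem5p3 (m : nat) (lam mu nu : seq nat)
  (m_gt0 : (0 < m)%N)
  (lam_part : partition_of m lam) (mu_part : partition_of m mu)
  (nu_part : partition_of m nu)
  (lam_len : plength lam = 4%N) (mu_len : plength mu = 2%N)
  (nu_len : plength nu = 2%N)
  (lam34 : part lam 3 = part lam 4)
  (lam3_nu2 : (2 * part lam 3 <= part nu 2)%N)
  (nu2_mu2 : (part nu 2 <= part mu 2)%N) :
  let l2 := (part lam 2)%:Z in
  let l3 := (part lam 3)%:Z in
  let m2 := (part mu 2)%:Z in
  let n2 := (part nu 2)%:Z in
  let x : int := Num.max 0 (ceil_half (n2 + m2 + l2 - l3 - m%:Z)) in
  let y : int := ceil_half (n2 + l2 - m2 - l3 + 1) in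
  let z : int := ceil_half (n2 + m2 - l2 - 3 * l3 + 1) in
  (l2 + l3 <= m2 ->
     kronecker m lam mu nu = ((y - x) * (x <= y)%R%:R)%:~R) /\
  (m2 < l2 + l3 ->
     kronecker m lam mu nu = ((z - x) * (x <= z)%R%:R)%:~R).
Proof.
rewrite /part /= in lam34 lam3_nu2 nu2_mu2 *.
have [/andP[sorted_lam /eqP sum_lam] /andP[sorted_mu /eqP sum_mu]] := (lam_part, mu_part).
have /andP[sorted_nu /eqP sum_nu] := nu_part.
have nth0 s n r : sorted geq s -> plength s = n -> (n <= r)%N -> nth 0%N s r = 0%N.
  move=> sorted_s len_s le_nr; apply/eqP; rewrite -leqn0 leqNgt nth_gt0_plength //.
  by rewrite len_s -leqNgt.
have lam_ge4 r := @nth0 lam 4%N r sorted_lam lam_len.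
have mu_ge2 r := @nth0 mu 2%N r sorted_mu mu_len.
have nu_ge2 r := @nth0 nu 2%N r sorted_nu nu_len.
have := sum_lam; rewrite (sumn_nth lam_ge4) !big_ord_recr big_ord0 /= add0n.
have := sum_mu; rewrite (sumn_nth mu_ge2) !big_ord_recr big_ord0 /= add0n.
have := sum_nu; rewrite (sumn_nth nu_ge2) !big_ord_recr big_ord0 /= add0n.
have lam10 := nth_partition_le sorted_lam (leqnSn 0).
have lam21 := nth_partition_le sorted_lam (leqnSn 1).
have mu10 := nth_partition_le sorted_mu (leqnSn 0).
have nu10 := nth_partition_le sorted_nu (leqnSn 0).
move=> e_nu e_mu e_lam.
set c := nth 0%N lam 2 in lam34 lam3_nu2 lam21 e_lam *.
set l2 := nth 0%N lam 1 in lam10 lam21 e_lam *.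
set m2 := nth 0%N mu 1 in nu2_mu2 mu10 e_mu *.
set n2 := nth 0%N nu 1 in nu2_mu2 lam3_nu2 nu10 e_nu *.
(* What remains after the c columns of length 4 are removed; it has only two rows because the third
   and fourth parts are equal. *)
pose lam' := [:: nth 0%N lam 0 - c; l2 - c]%N; pose m' := sumn lam'.
have em : m = (#|{: bool * bool * 'I_c}| + m')%N.
  by rewrite card_prod card_prod !card_bool card_ord /m' /=; lia.
have em' : m'%:Z = m%:Z - 4 * c%:Z by rewrite /m' /=; lia.
have chi_lam' : chiS m' lam' = psi m' (l2%:Z - c%:Z).
  rewrite chiS_two_rows //=; [|by case=> [|[|[|r]]]|lia|by rewrite /m' /=; lia].
  by congr psi; lia.
have kroneckerE : kronecker m lam mu nu =
    ((nline m' ((m2%:Z - 2 * c%:Z) - (l2%:Z - c%:Z)) (n2%:Z - 2 * c%:Z))%:Z -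
     (nline m' (m'%:Z - (l2%:Z - c%:Z) - (m2%:Z - 2 * c%:Z) + 1) (n2%:Z - 2 * c%:Z))%:Z)%:~R.
  rewrite -cfdot_psi3; [|lia..]; rewrite -chi_lam' /kronecker.
  rewrite (chiS_two_rows sum_mu) ?(chiS_two_rows sum_nu) //; [|lia..].
  rewrite cfdot_mul_real; last exact: psi_real.
  (* Stated for all levels, so that it applies to the four products arising from the two differences
     of permutation characters. *)
  have strip p q : '[chiS m lam, phi m p * phi m q] =
      '[chiS m' lam', phi m' (p - 2 * c%:Z) * phi m' (q - 2 * c%:Z)].
    move: sum_lam; rewrite em => sum_lam'.
    rewrite (@cfdot_chiS_remove_columns c m' lam lam') //.
      by case=> [|[|[|[|r]]]] //=; lia.
    by move=> r le4r; rewrite lam_ge4 //; case: r le4r => [|[|[|r]]].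
  rewrite /psi !mulrBl !mulrBr !cfdotBr !strip.
  by rewrite !(addrAC _ (- 1)).
have half := ceil_half_bounds.
(* Passes from truncated line counts to the factor (Y >= x). If Y < max(0, X), then X <= Y forces Y
   < 0 and X < 0, and both sides vanish. *)
have clip Y X : X <= Y -> Num.max 0 Y - Num.max 0 X =
    (Y - Num.max 0 X) * (Num.max 0 X <= Y)%R%:R :> int.
  by case: (lerP (Num.max 0 X) Y) => h le_XY;
    rewrite /= ?mulr1n ?mulr0n ?mulr1 ?mulr0; lia.
have le_ceil_half u v : u <= v -> ceil_half u <= ceil_half v.
  by move=> le_uv; have := half u; have := half v; lia.
(* The first line sits at mu_2 - lambda_2 - lambda_3, which is nonnegative in case (1); in case (2)
   it is negative and is reflected, which replaces y by z. The second line gives x in both cases. *)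
rewrite kroneckerE; split=> h; congr (_%:~R).
  rewrite !nline_ceil_half -?clip; [|apply: le_ceil_half; lia|lia..].
  by congr (Num.max 0 (ceil_half _) - Num.max 0 (ceil_half _)); lia.
rewrite -(nline_opp _ (_ - _ - (_ - _))) !nline_ceil_half -?clip;
  [|apply: le_ceil_half; lia|lia..].
by congr (Num.max 0 (ceil_half _) - Num.max 0 (ceil_half _)); lia.
Qed.
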